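(* Let $R$ be a commutative ring and $B$ an $R$-module with an associative unital $R$-algebra structure $(m,e)$ and a coassociative counital $R$-coalgebra structure $(\delta,\varepsilon)$. Equip $B\otimes_R-$ with the induced monad and comonad structures and the transformation $\lambda$ derived from the twist map, and equip its right adjoint $\mathrm{Hom}_R(B,-)$ with the mates of these. (1) $B$ is a Hopf algebra over $R$ if and only if the endofunctor $B\otimes_R-$ on the category of $R$-modules is a Hopf monad (a bimonad with antipode). (2) $B\otimes_R-$ is a bimonad if and only if $\mathrm{Hom}_R(B,-)$ is a bimonad; and $B\otimes_R-$ is a bimonad with antipode if and only if $\mathrm{Hom}_R(B,-)$ is a bimonad with antipode. (3) If $B$ is finitely generated and projective as an $R$-module, then $B$ is a Hopf algebra if and only if $B^*=\mathrm{Hom}_R(B,R)$ (with the dual algebra and coalgebra structures) is a Hopf algebra.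
   Context: The structures on $H=B\otimes_R-$ are $m\otimes-$, $e\otimes-$, $\delta\otimes-$, $\varepsilon\otimes-$ and $\lambda=(mH)\cdot(H\tau)\cdot(\delta H):HH\to HH$, where $\tau=\mathrm{tw}\otimes-:HH\to HH$ and $\mathrm{tw}:B\otimes_RB\to B\otimes_RB$ is $b\otimes c\mapsto c\otimes b$. ''$H$ is a bimonad'' means: $\varepsilon\cdot e=1$, $\varepsilon\cdot m=\varepsilon\cdot H\varepsilon$, $\delta\cdot e=eH\cdot e$, $\lambda$ is an entwining from the monad to the comonad ($\lambda\cdot eH=He$, $\varepsilon H\cdot\lambda=H\varepsilon$, $\delta H\cdot\lambda=H\lambda\cdot\lambda H\cdot H\delta$, $\lambda\cdot mH=Hm\cdot\lambda H\cdot H\lambda$), and $\delta\cdot m=Hm\cdot\lambda H\cdot H\delta$. Let $T=\mathrm{Hom}_R(B,-)$, right adjoint to $H$; then $H^n\dashv T^n$, and the mate of $\alpha:H^p\to H^q$ is the composite $T^q\to T^pH^pT^q\xrightarrow{T^p\alpha T^q}T^pH^qT^q\to T^p$ formed with the unit of $H^p\dashv T^p$ and the counit of $H^q\dashv T^q$. The monad structure $(m_T,e_T)$ of $T$ consists of the mates of $\delta\otimes-,\varepsilon\otimes-$; its comonad structure $(\delta_T,\varepsilon_T)$ of the mates of $m\otimes-,e\otimes-$; $\lambda_T:TT\to TT$ is the mate of $\lambda$. ''$T$ is a bimonad'' means: $\varepsilon_T\cdot e_T=1$, $\varepsilon_T\cdot m_T=\varepsilon_T\cdot T\varepsilon_T$,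 $\delta_T\cdot e_T=e_TT\cdot e_T$, $\lambda_T$ is an entwining from the comonad to the monad ($\lambda_T\cdot Te_T=e_TT$, $T\varepsilon_T\cdot\lambda_T=\varepsilon_TT$, $T\delta_T\cdot\lambda_T=\lambda_TT\cdot T\lambda_T\cdot\delta_TT$, $\lambda_T\cdot Tm_T=m_TT\cdot T\lambda_T\cdot\lambda_TT$), and $\delta_T\cdot m_T=m_TT\cdot T\lambda_T\cdot\delta_TT$. An antipode on an endofunctor $X$ with monad structure $(m,e)$ and comonad structure $(\delta,\varepsilon)$ is a natural transformation $S:X\to X$ with $m\cdot SX\cdot\delta=e\cdot\varepsilon=m\cdot XS\cdot\delta$. *)

(* Defs.v *)
From HB Require Import structures.
From mathcomp Require Import all_boot all_order all_algebra generic_quotient.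
From mathcomp Require Import boolp.

Set Implicit Arguments.
Unset Strict Implicit.
Unset Printing Implicit Defensive.

Import GRing.Theory.
Local Open Scope quotient_scope.
Local Open Scope ring_scope.

(* A commutative ring is a comPzRingType, so the zero ring is allowed, and an
   R-module is an lmodType R. *)

Definition Hom (R : comPzRingType) (M N : lmodType R) : Type :=
  {linear M -> N}.

Lemma hom_ext (R : comPzRingType) (M N : lmodType R) (f g : Hom M N) :
  (forall x, f x = g x) -> f = g.
Proof.
move: f g => [f cf] [g cg] /= /funext fg.
have {fg} efg : f = g := fg.
subst g; congr (GRing.Linear.Pack _).
move: cf cg => [[a] [b]] [[a'] [b']].
by rewrite (Prop_irrelevance a a') (Prop_irrelevance b b').
Qed.

Definition mkHom (R : comPzRingType) (M N : lmodType R) (f : M -> N)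
    (Hf : linear f) : Hom M N :=
  HB.pack_for {linear M -> N} f (GRing.isLinear.Build R M N *:%R f Hf).

Definition hid (R : comPzRingType) (M : lmodType R) : Hom M M :=
  (idfun : {linear M -> M}).

Definition hcomp (R : comPzRingType) (M N P : lmodType R)
  (g : Hom N P) (f : Hom M N) : Hom M P := (g \o f : {linear M -> P}).

Notation "g \oh f" := (hcomp g f) (at level 50, left associativity).

Lemma hcompE (R : comPzRingType) (M N P : lmodType R) (g : Hom N P)
  (f : Hom M N) x : (g \oh f) x = g (f x).
Proof. by []. Qed.

Lemma hcompA (R : comPzRingType) (M N P Q : lmodType R) (h : Hom P Q)
  (g : Hom N P) (f : Hom M N) : h \oh (g \oh f) = h \oh g \oh f.
Proof. exact: hom_ext. Qed.
Lemma hcomp1h (R : comPzRingType) (M N : lmodType R) (f : Hom M N) :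
  hid N \oh f = f.
Proof. exact: hom_ext. Qed.
Lemma hcomph1 (R : comPzRingType) (M N : lmodType R) (f : Hom M N) :
  f \oh hid M = f.
Proof. exact: hom_ext. Qed.

Section HomModule.
Variables (R : comPzRingType) (M N : lmodType R).
Implicit Types f g h : Hom M N.

HB.instance Definition _ := gen_eqMixin (Hom M N).
HB.instance Definition _ := gen_choiceMixin (Hom M N).

Definition hzero : Hom M N := (\0 : {linear M -> N}).
Definition hadd f g : Hom M N := (f \+ g : {linear M -> N}).
Definition hopp f : Hom M N := (\- f : {linear M -> N}).
Definition hscale (a : R) f : Hom M N := (a \*: f : {linear M -> N}).

Fact haddA : associative hadd.
Proof. by move=> f g h; apply: hom_ext => x /=; rewrite addrA. Qed.
Fact haddC : commutative hadd.
Proof. by move=> f g; apply: hom_ext => x /=; rewrite addrC. Qed.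
Fact hadd0 : left_id hzero hadd.
Proof. by move=> f; apply: hom_ext => x /=; rewrite add0r. Qed.
Fact haddN : left_inverse hzero hopp hadd.
Proof. by move=> f; apply: hom_ext => x /=; rewrite addNr. Qed.

HB.instance Definition _ :=
  GRing.isZmodule.Build (Hom M N) haddA haddC hadd0 haddN.

Fact hscaleA a b f : hscale a (hscale b f) = hscale (a * b) f.
Proof. by apply: hom_ext => x /=; rewrite scalerA. Qed.
Fact hscale1 : left_id 1 hscale.
Proof. by move=> f; apply: hom_ext => x /=; rewrite scale1r. Qed.
Fact hscaleDr : right_distributive hscale +%R.
Proof. by move=> a f g; apply: hom_ext => x /=; rewrite scalerDr. Qed.
Fact hscaleDl f : {morph hscale^~ f : a b / a + b}.
Proof. by move=> a b; apply: hom_ext => x /=; rewrite scalerDl. Qed.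

HB.instance Definition _ :=
  GRing.Zmodule_isLmodule.Build R (Hom M N) hscaleA hscale1 hscaleDr hscaleDl.

Lemma homD f g x : (f + g) x = f x + g x. Proof. by []. Qed.
Lemma homZ a f x : (a *: f) x = a *: f x. Proof. by []. Qed.
End HomModule.

(* A list [:: (x1, y1); ...; (xn, yn)] stands for the sum of the xi (x) yi;
   two lists are identified when bilinearity forces it. *)
Inductive tens_rel (R : comPzRingType) (M N : lmodType R) :
    seq (M * N) -> seq (M * N) -> Prop :=
| Tens_refl s : tens_rel s s
| Tens_sym s t : tens_rel s t -> tens_rel t s
| Tens_trans s t u : tens_rel s t -> tens_rel t u -> tens_rel s u
| Tens_cat s s' t t' :
    tens_rel s s' -> tens_rel t t' -> tens_rel (s ++ t) (s' ++ t')
| Tens_comm s t : tens_rel (s ++ t) (t ++ s)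
| Tens_0l y : tens_rel [:: (0, y)] [::]
| Tens_addl x x' y : tens_rel [:: (x + x', y)] [:: (x, y); (x', y)]
| Tens_addr x y y' : tens_rel [:: (x, y + y')] [:: (x, y); (x, y')]
| Tens_scale (a : R) x y : tens_rel [:: (a *: x, y)] [:: (x, a *: y)].

Section TensorQuotient.
Variables (R : comPzRingType) (M N : lmodType R).

Definition tens_relb (s t : seq (M * N)) : bool := `[< tens_rel s t >].

Fact tens_relb_refl : reflexive tens_relb.
Proof. by move=> s; apply/asboolP; constructor. Qed.
Fact tens_relb_sym : symmetric tens_relb.
Proof. by move=> s t; apply/asboolP/asboolP => /Tens_sym. Qed.
Fact tens_relb_trans : transitive tens_relb.
Proof.
by move=> t s u /asboolP st /asboolP tu; apply/asboolP/(Tens_trans st tu).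
Qed.

Canonical tens_equiv :=
  EquivRel tens_relb tens_relb_refl tens_relb_sym tens_relb_trans.

Definition tens : Type := {eq_quot tens_equiv}.

HB.instance Definition _ := Choice.on tens.
HB.instance Definition _ := EqQuotient.on tens.

Definition tens_class (s : seq (M * N)) : tens := \pi_tens s.
Definition tens_repr (x : tens) : seq (M * N) := repr x.

Lemma tens_reprK x : tens_class (tens_repr x) = x.
Proof. exact: reprK. Qed.

Lemma tens_classP s t : tens_class s = tens_class t <-> tens_rel s t.
Proof. by split=> [/eqquotP/asboolP | st]; last by apply/eqquotP/asboolP. Qed.

Lemma tens_repr_class s : tens_rel (tens_repr (tens_class s)) s.
Proof. by apply/tens_classP; rewrite tens_reprK. Qed.

Definition tzero : tens := tens_class [::].
Definition tadd (x y : tens) : tens :=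
  tens_class (tens_repr x ++ tens_repr y).
Definition tscale (a : R) (x : tens) : tens :=
  tens_class [seq (a *: p.1, p.2) | p <- tens_repr x].
Definition topp (x : tens) : tens := tscale (-1) x.

Lemma taddE s t : tadd (tens_class s) (tens_class t) = tens_class (s ++ t).
Proof. by apply/tens_classP/Tens_cat; apply: tens_repr_class. Qed.

Lemma tens_rel_scale (a : R) (s t : seq (M * N)) : tens_rel s t ->
  @tens_rel R M N [seq (a *: p.1, p.2) | p <- s] [seq (a *: p.1, p.2) | p <- t].
Proof.
elim=> {s t} /=.
- by constructor.
- by move=> s t _; apply: Tens_sym.
- by move=> s t u _ st _; apply: Tens_trans st.
- by move=> s s' t t' _ ss' _ tt'; rewrite !map_cat; apply: Tens_cat.
- by move=> s t; rewrite !map_cat; apply: Tens_comm.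
- by move=> y; rewrite scaler0; constructor.
- by move=> x x' y; rewrite scalerDr; constructor.
- by move=> x y y'; constructor.
- by move=> b x y; rewrite scalerA mulrC -scalerA; constructor.
Qed.

Lemma tscaleE a s :
  tscale a (tens_class s) = tens_class [seq (a *: p.1, p.2) | p <- s].
Proof. by apply/tens_classP/tens_rel_scale/tens_repr_class. Qed.

Fact taddA : associative tadd.
Proof.
move=> x y z; rewrite -(tens_reprK x) -(tens_reprK y) -(tens_reprK z).
by rewrite !taddE catA.
Qed.
Fact taddC : commutative tadd.
Proof. by move=> x y; apply/tens_classP; constructor. Qed.
Fact tadd0 : left_id tzero tadd.
Proof. by move=> x; rewrite -(tens_reprK x) /tzero taddE. Qed.

Fact tscaleDl x : {morph tscale^~ x : a b / a + b >-> tadd a b}.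
Proof.
move=> a b; rewrite -(tens_reprK x) !tscaleE taddE; apply/tens_classP.
elim: (tens_repr x) => [|[m n] s IHs] /=; first by constructor.
rewrite -cat1s scalerDl -[in X in tens_rel _ X]cat1s.
apply: (Tens_trans (Tens_cat (Tens_addl _ _ _) IHs)) => /=.
rewrite -cat1s -[X in tens_rel _ X]cat1s.
apply: Tens_cat; first by constructor.
set u := map _ _; set v := map _ _.
rewrite -(cat1s _ v) -(cat1s _ (u ++ v)) !catA.
by apply: Tens_cat; [apply: Tens_comm | constructor].
Qed.

Fact tscale0 x : tscale 0 x = tzero.
Proof.
rewrite -(tens_reprK x) tscaleE; apply/tens_classP.
elim: (tens_repr x) => [|[m n] s IHs] /=; first by constructor.
rewrite -cat1s -[X in tens_rel _ X]/([::] ++ [::]) scale0r.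
by apply: Tens_cat => //; constructor.
Qed.

Fact tscale1 : left_id 1 tscale.
Proof.
move=> x; rewrite -{1}(tens_reprK x) tscaleE -[RHS]tens_reprK; congr tens_class.
by rewrite -[RHS]map_id; apply: eq_map => -[m n] /=; rewrite scale1r.
Qed.

Fact taddN : left_inverse tzero topp tadd.
Proof. by move=> x; rewrite /topp -{2}(tscale1 x) -tscaleDl addNr tscale0. Qed.

HB.instance Definition _ := GRing.isZmodule.Build tens taddA taddC tadd0 taddN.

Fact tscaleA a b x : tscale a (tscale b x) = tscale (a * b) x.
Proof.
rewrite -(tens_reprK x) !tscaleE -map_comp; congr tens_class.
by apply: eq_map => -[m n] /=; rewrite scalerA.
Qed.
Fact tscaleDr : right_distributive tscale +%R.
Proof.
move=> a x y; rewrite -(tens_reprK x) -(tens_reprK y).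
by rewrite [_ + _]taddE !tscaleE map_cat [RHS]taddE.
Qed.

HB.instance Definition _ :=
  GRing.Zmodule_isLmodule.Build R tens tscaleA tscale1 tscaleDr tscaleDl.

Definition pure (x : M) (y : N) : tens := tens_class [:: (x, y)].

Lemma pureDl x x' y : pure (x + x') y = pure x y + pure x' y.
Proof. by rewrite [RHS]taddE; apply/tens_classP; constructor. Qed.
Lemma pureDr x y y' : pure x (y + y') = pure x y + pure x y'.
Proof. by rewrite [RHS]taddE; apply/tens_classP; constructor. Qed.
Lemma pureZl a x y : pure (a *: x) y = a *: pure x y.
Proof. by rewrite [RHS]tscaleE. Qed.
Lemma pureZr a x y : pure x (a *: y) = a *: pure x y.
Proof. by rewrite -pureZl; apply/tens_classP/Tens_sym; constructor. Qed.

Lemma tensE (x : tens) : x = \sum_(p <- tens_repr x) pure p.1 p.2.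
Proof.
rewrite -{1}(tens_reprK x); elim: (tens_repr x) => [|[m n] s IHs].
  by rewrite big_nil.
by rewrite big_cons -IHs [RHS]taddE.
Qed.
End TensorQuotient.

Definition tensor (R : comPzRingType) (M N : lmodType R) : lmodType R :=
  tens M N.
Definition homM (R : comPzRingType) (M N : lmodType R) : lmodType R :=
  Hom M N.
Definition regM (R : comPzRingType) : lmodType R := R^o.
Definition pureT (R : comPzRingType) (M N : lmodType R) (x : M) (y : N) :
  tensor M N := pure x y.

Notation "M *t* N" := (tensor M N) (at level 40, left associativity).
Notation "x ** y" := (pureT x y) (at level 40, left associativity).

Definition bilinear_map (R : comPzRingType) (M N P : lmodType R)
    (g : M -> N -> P) : Prop :=
  (forall x, linear (g x)) /\ (forall y, linear (g^~ y)).

Section TensorUniversal.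
Variables (R : comPzRingType) (M N P : lmodType R).

Lemma pureTDl (x x' : M) (y : N) : (x + x') ** y = x ** y + x' ** y.
Proof. exact: pureDl. Qed.
Lemma pureTDr (x : M) (y y' : N) : x ** (y + y') = x ** y + x ** y'.
Proof. exact: pureDr. Qed.
Lemma pureTZl a (x : M) (y : N) : (a *: x) ** y = a *: (x ** y).
Proof. exact: pureZl. Qed.
Lemma pureTZr a (x : M) (y : N) : x ** (a *: y) = a *: (x ** y).
Proof. exact: pureZr. Qed.

Lemma pure_bilinear : bilinear_map (@pureT R M N).
Proof.
by split=> u a x y; rewrite ?pureTDl ?pureTDr ?pureTZl ?pureTZr.
Qed.

Definition tlift_fun (g : M -> N -> P) (x : M *t* N) : P :=
  \sum_(p <- tens_repr x) g p.1 p.2.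

Lemma tlift_class g : bilinear_map g -> forall s,
  tlift_fun g (tens_class s) = \sum_(p <- s) g p.1 p.2.
Proof.
move=> [gr gl] s; rewrite /tlift_fun.
have gD x y y' : g x (y + y') = g x y + g x y' by exact: linearD (mkHom (gr x)) y y'.
have gDl x x' y : g (x + x') y = g x y + g x' y.
  exact: linearD (mkHom (gl y)) x x'.
have g0 y : g 0 y = 0 by exact: linear0 (mkHom (gl y)).
have gZl a x y : g (a *: x) y = a *: g x y.
  exact: linearZ_LR (mkHom (gl y)) a x.
have gZr a x y : g x (a *: y) = a *: g x y.
  exact: linearZ_LR (mkHom (gr x)) a y.
suff rel_sum u v : tens_rel u v ->
  \sum_(p <- u) g p.1 p.2 = \sum_(p <- v) g p.1 p.2.
  exact/rel_sum/tens_repr_class.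
elim=> {s u v} //=.
- by move=> s t u _ -> _ ->.
- by move=> s s' t t' _ ss' _ tt'; rewrite !big_cat /= ss' tt'.
- by move=> s t; rewrite !big_cat /= addrC.
- by move=> y; rewrite big_seq1 big_nil /= g0.
- by move=> x x' y; rewrite !big_cons !big_nil !addr0 /= gDl.
- by move=> x y y'; rewrite !big_cons !big_nil !addr0 /= gD.
by move=> a x y; rewrite !big_seq1 /= gZl gZr.
Qed.

Lemma tlift_linear g : bilinear_map g -> linear (tlift_fun g).
Proof.
move=> bg a x y; rewrite -(tens_reprK x) -(tens_reprK y).
rewrite -[a *: _]/(tscale a _) -[_ + _]/(tadd _ _) tscaleE taddE !tlift_class //.
rewrite big_cat /= big_map scaler_sumr; congr (_ + _).
apply: eq_bigr => p _ /=.
have [_ /(_ p.2) gl] := bg.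
exact: linearZ_LR (mkHom gl) a p.1.
Qed.

Definition tlift (g : M -> N -> P) (bg : bilinear_map g) : Hom (M *t* N) P :=
  mkHom (tlift_linear bg).

Lemma tliftE g (bg : bilinear_map g) x y : tlift bg (x ** y) = g x y.
Proof. by rewrite /tlift /= tlift_class // big_seq1. Qed.

Lemma tens_ext (f g : Hom (M *t* N) P) :
  (forall x y, f (x ** y) = g (x ** y)) -> f = g.
Proof.
by move=> fg; apply: hom_ext => z; rewrite (tensE z) !linear_sum; apply: eq_bigr => p _; apply: fg.
Qed.
End TensorUniversal.

Arguments tlift : simpl never.

Section TensorMaps.
Variable R : comPzRingType.
Implicit Types M N P : lmodType R.

Definition purel M N (x : M) : Hom N (M *t* N) :=
  mkHom (proj1 (@pure_bilinear R M N) x).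
Definition purer M N (y : N) : Hom M (M *t* N) :=
  mkHom (proj2 (@pure_bilinear R M N) y).

Fact tmap_subproof M M' N N' (f : Hom M M') (g : Hom N N') :
  bilinear_map (fun x y => f x ** g y).
Proof.
by split=> u a x y; rewrite /= linearP ?pureTDl ?pureTDr ?pureTZl ?pureTZr.
Qed.
Definition tmap M M' N N' (f : Hom M M') (g : Hom N N') :
  Hom (M *t* N) (M' *t* N') := tlift (tmap_subproof f g).

Lemma tmapE M M' N N' (f : Hom M M') (g : Hom N N') x y :
  tmap f g (x ** y) = f x ** g y.
Proof. exact: tliftE. Qed.

Lemma tmap_id M N : tmap (hid M) (hid N) = hid (M *t* N).
Proof. by apply: tens_ext => x y; rewrite tmapE. Qed.

Lemma tmap_comp M M' M'' N N' N'' (f : Hom M M') (f' : Hom M' M'')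
    (g : Hom N N') (g' : Hom N' N'') :
  tmap (f' \oh f) (g' \oh g) = tmap f' g' \oh tmap f g.
Proof. by apply: tens_ext => x y; rewrite [RHS]hcompE !tmapE. Qed.

Fact tassoc_subproof M N P :
  bilinear_map (fun (x : M) (t : N *t* P) => tmap (purel N x) (hid P) t).
Proof.
split=> [x a t u | t a x x']; first by rewrite linearP.
pose f := tmap (purel N (a *: x + x')) (hid P).
pose g : Hom _ _ := a *: tmap (purel N x) (hid P) + tmap (purel N x') (hid P).
suff fg : f = g by rewrite -[LHS]/(f t) fg.
by apply: tens_ext => y z; rewrite homD homZ !tmapE /= !(pureTDl, pureTZl).
Qed.
Arguments tmap : simpl never.

(* x (x) (y (x) z) |-> (x (x) y) (x) z *)
Definition tassoc M N P : Hom (M *t* (N *t* P)) (M *t* N *t* P) :=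
  tlift (@tassoc_subproof M N P).

Lemma tassocE M N P (x : M) (y : N) (z : P) :
  tassoc M N P (x ** (y ** z)) = x ** y ** z.
Proof. by rewrite tliftE tmapE. Qed.

Fact tassocV_subproof M N P :
  bilinear_map (fun (t : M *t* N) (z : P) => tmap (hid M) (purer N z) t).
Proof.
split=> [t a z z' | z a t u]; last by rewrite linearP.
pose f := tmap (hid M) (purer N (a *: z + z')).
pose g : Hom _ _ := a *: tmap (hid M) (purer N z) + tmap (hid M) (purer N z').
suff fg : f = g by rewrite -[LHS]/(f t) fg.
by apply: tens_ext => x y; rewrite homD homZ !tmapE /= !(pureTDr, pureTZr).
Qed.
(* (x (x) y) (x) z |-> x (x) (y (x) z) *)
Definition tassocV M N P : Hom (M *t* N *t* P) (M *t* (N *t* P)) :=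
  tlift (@tassocV_subproof M N P).

Lemma tassocVE M N P (x : M) (y : N) (z : P) :
  tassocV M N P (x ** y ** z) = x ** (y ** z).
Proof. by rewrite tliftE tmapE. Qed.

Fact tlunit_subproof M : bilinear_map (fun (a : regM R) (x : M) => a *: x).
Proof.
split=> [a b x y | x a b c]; last by rewrite scalerDl scalerA.
by rewrite scalerDr !scalerA mulrC.
Qed.
(* a (x) x |-> a x *)
Definition tlunit M : Hom (regM R *t* M) M := tlift (@tlunit_subproof M).
(* x |-> 1 (x) x *)
Definition tlunitV M : Hom M (regM R *t* M) := purel M (1 : regM R).

Fact trunit_subproof M : bilinear_map (fun (x : M) (a : regM R) => a *: x).
Proof. by have [? ?] := tlunit_subproof M; split. Qed.
(* x (x) a |-> a x *)
Definition trunit M : Hom (M *t* regM R) M := tlift (@trunit_subproof M).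
(* x |-> x (x) 1 *)
Definition trunitV M : Hom M (M *t* regM R) := purer M (1 : regM R).

Fact twist_subproof M N : bilinear_map (fun (x : M) (y : N) => y ** x).
Proof. by have [? ?] := @pure_bilinear R N M; split. Qed.
Definition twist M N : Hom (M *t* N) (N *t* M) := tlift (@twist_subproof M N).

Lemma tlunitE M (a : regM R) (x : M) : tlunit M (a ** x) = (a : R) *: x.
Proof. exact: tliftE. Qed.
Lemma trunitE M (x : M) (a : regM R) : trunit M (x ** a) = (a : R) *: x.
Proof. exact: tliftE. Qed.
Lemma twistE M N (x : M) (y : N) : twist M N (x ** y) = y ** x.
Proof. exact: tliftE. Qed.

Lemma tens_ext3 M N P Q (f g : Hom (M *t* (N *t* P)) Q) :
  (forall x y z, f (x ** (y ** z)) = g (x ** (y ** z))) -> f = g.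
Proof.
move=> fg; apply: tens_ext => x t.
rewrite -[LHS]/((f \oh purel _ x) t) -[RHS]/((g \oh purel _ x) t).
suff -> : f \oh purel _ x = g \oh purel _ x by [].
by apply: tens_ext => y z; apply: fg.
Qed.

Lemma tens_ext3V M N P Q (f g : Hom (M *t* N *t* P) Q) :
  (forall x y z, f (x ** y ** z) = g (x ** y ** z)) -> f = g.
Proof.
move=> fg; apply: tens_ext => t z.
rewrite -[LHS]/((f \oh purer _ z) t) -[RHS]/((g \oh purer _ z) t).
suff -> : f \oh purer _ z = g \oh purer _ z by [].
by apply: tens_ext => x y; apply: fg.
Qed.

Lemma tassoc_nat M N P M' N' P' (f : Hom M M') (g : Hom N N') (h : Hom P P') :
  tassoc M' N' P' \oh tmap f (tmap g h) = tmap (tmap f g) h \oh tassoc M N P.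
Proof.
by apply: tens_ext3 => x y z; rewrite !hcompE tassocE !tmapE tassocE.
Qed.

Lemma tassocV_nat M N P M' N' P' (f : Hom M M') (g : Hom N N') (h : Hom P P') :
  tassocV M' N' P' \oh tmap (tmap f g) h
    = tmap f (tmap g h) \oh tassocV M N P.
Proof.
by apply: tens_ext3V => x y z; rewrite !hcompE tassocVE !tmapE tassocVE.
Qed.

Lemma tassocVK M N P : tassocV M N P \oh tassoc M N P = hid _.
Proof. by apply: tens_ext3 => x y z; rewrite !hcompE tassocE tassocVE. Qed.
Lemma tassocK M N P : tassoc M N P \oh tassocV M N P = hid _.
Proof. by apply: tens_ext3V => x y z; rewrite !hcompE tassocVE tassocE. Qed.

Lemma tlunit_nat M N (f : Hom M N) :
  tlunit N \oh tmap (hid _) f = f \oh tlunit M.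
Proof.
by apply: tens_ext => a x; rewrite !hcompE tmapE !tlunitE linearZ_LR.
Qed.

Lemma tlunitV_nat M N (f : Hom M N) :
  tlunitV N \oh f = tmap (hid _) f \oh tlunitV M.
Proof. by apply: hom_ext => x; rewrite !hcompE tmapE. Qed.

Lemma tmap_exch M M' N N' (f : Hom M M') (g : Hom N N') :
  tmap f (hid _) \oh tmap (hid _) g = tmap (hid _) g \oh tmap f (hid _).
Proof. by rewrite -!tmap_comp !hcomp1h !hcomph1. Qed.
End TensorMaps.

Record algebra (R : comPzRingType) (B : lmodType R) := Algebra {
  amul : Hom (B *t* B) B;
  aunit : Hom (regM R) B;
  amulA : amul \oh tmap amul (hid B) \oh tassoc B B B
            = amul \oh tmap (hid B) amul;
  amul1l : amul \oh tmap aunit (hid B) \oh tlunitV B = hid B;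
  amul1r : amul \oh tmap (hid B) aunit \oh trunitV B = hid B }.

Record coalgebra (R : comPzRingType) (B : lmodType R) := Coalgebra {
  ccomul : Hom B (B *t* B);
  ccounit : Hom B (regM R);
  ccomulA : tmap ccomul (hid B) \oh ccomul
              = tassoc B B B \oh tmap (hid B) ccomul \oh ccomul;
  ccounitl : tlunit B \oh tmap ccounit (hid B) \oh ccomul = hid B;
  ccounitr : trunit B \oh tmap (hid B) ccounit \oh ccomul = hid B }.

Section HopfAlgebra.
Variables (R : comPzRingType) (B : lmodType R).
Variables (A : algebra B) (C : coalgebra B).
Local Notation m := (amul A).
Local Notation e := (aunit A).
Local Notation delta := (ccomul C).
Local Notation eps := (ccounit C).

(* (a (x) b) (x) (c (x) d) |-> (a (x) c) (x) (b (x) d) *)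
Definition middle_twist : Hom (B *t* B *t* (B *t* B)) (B *t* B *t* (B *t* B)) :=
  tassoc B B (B *t* B)
  \oh tmap (hid B) (tassocV B B B \oh tmap (twist B B) (hid B) \oh tassoc B B B)
  \oh tassocV B B (B *t* B).

Definition is_bialgebra : Prop :=
  [/\ delta \oh m = tmap m m \oh middle_twist \oh tmap delta delta,
      delta \oh e = tmap e e \oh tlunitV (regM R),
      eps \oh m = tlunit (regM R) \oh tmap eps eps
    & eps \oh e = hid (regM R)].

Definition is_antipode (S : Hom B B) : Prop :=
  m \oh tmap S (hid B) \oh delta = e \oh eps /\
  m \oh tmap (hid B) S \oh delta = e \oh eps.

Definition is_hopf_algebra : Prop :=
  is_bialgebra /\ exists S : Hom B B, is_antipode S.
End HopfAlgebra.

Record endofunctor (R : comPzRingType) := Endofunctor {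
  fobj :> lmodType R -> lmodType R;
  fmap : forall M N, Hom M N -> Hom (fobj M) (fobj N);
  fmap_id : forall M, fmap (hid M) = hid (fobj M);
  fmap_comp : forall M N P (g : Hom N P) (f : Hom M N),
    fmap (g \oh f) = fmap g \oh fmap f }.

Record nattrans (R : comPzRingType) (F G : endofunctor R) := Nattrans {
  ncomp :> forall M : lmodType R, Hom (F M) (G M);
  naturality : forall (M N : lmodType R) (f : Hom M N),
    ncomp N \oh fmap F f = fmap G f \oh ncomp M }.

Notation "F ~~> G" := (nattrans F G) (at level 70, no associativity)
  : type_scope.

Section Functors.
Variable R : comPzRingType.
Implicit Types (F G : endofunctor R) (M N P : lmodType R).

Definition fid : endofunctor R :=
  @Endofunctor R (fun M => M) (fun _ _ f => f) (fun _ => erefl)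
    (fun _ _ _ _ _ => erefl).

Fact fcomp_id F G M : fmap F (fmap G (hid M)) = hid (F (G M)).
Proof. by rewrite !fmap_id. Qed.
Fact fcomp_comp F G M N P (g : Hom N P) (f : Hom M N) :
  fmap F (fmap G (g \oh f)) = fmap F (fmap G g) \oh fmap F (fmap G f).
Proof. by rewrite !fmap_comp. Qed.

Definition fcomp F G : endofunctor R :=
  @Endofunctor R (fun M => F (G M)) (fun _ _ f => fmap F (fmap G f))
    (fcomp_id F G) (@fcomp_comp F G).
End Functors.

Notation "F \of G" := (fcomp F G) (at level 50, left associativity).

Record adjunction (R : comPzRingType) (F G : endofunctor R) := Adjunction {
  adj_unit : fid R ~~> G \of F;
  adj_counit : F \of G ~~> fid R;
  adj_triangleF : forall M,
    adj_counit (F M) \oh fmap F (adj_unit M) = hid (F M);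
  adj_triangleG : forall M,
    fmap G (adj_counit M) \oh adj_unit (G M) = hid (G M) }.

Section IdentityAdjunction.
Variable R : comPzRingType.

Fact hid_natural (M N : lmodType R) (f : Hom M N) : hid N \oh f = f \oh hid M.
Proof. exact: hom_ext. Qed.

Definition adj_id : adjunction (fid R) (fid R) :=
  @Adjunction R (fid R) (fid R)
    (@Nattrans R (fid R) (fid R \of fid R) (@hid R) hid_natural)
    (@Nattrans R (fid R \of fid R) (fid R) (@hid R) hid_natural)
    (fun M => hcomp1h _) (fun M => hcomp1h _).
End IdentityAdjunction.

Section Adjunctions.
Variables (R : comPzRingType) (F G F' G' : endofunctor R).
Implicit Types M N : lmodType R.

Fact adj_unit_nat (a : adjunction F G) M N (f : Hom M N) :
  adj_unit a N \oh f = fmap G (fmap F f) \oh adj_unit a M.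
Proof. exact: (naturality (adj_unit a)). Qed.
Fact adj_counit_nat (a : adjunction F G) M N (f : Hom M N) :
  adj_counit a N \oh fmap F (fmap G f) = f \oh adj_counit a M.
Proof. exact: (naturality (adj_counit a)). Qed.
End Adjunctions.

Section AdjunctionComposition.
Variables (R : comPzRingType) (F G F' G' : endofunctor R).
Variables (a : adjunction F G) (a' : adjunction F' G').
Implicit Types M N : lmodType R.

Definition adj_comp_unit M : Hom M (G' (G (F (F' M)))) :=
  fmap G' (adj_unit a (F' M)) \oh adj_unit a' M.
Definition adj_comp_counit M : Hom (F (F' (G' (G M)))) M :=
  adj_counit a M \oh fmap F (adj_counit a' (G M)).

Fact adj_comp_unit_nat M N (f : Hom M N) :
  adj_comp_unit N \oh f
    = fmap G' (fmap G (fmap F (fmap F' f))) \oh adj_comp_unit M.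
Proof.
rewrite /adj_comp_unit -hcompA adj_unit_nat !hcompA -!fmap_comp.
by rewrite adj_unit_nat.
Qed.

Fact adj_comp_counit_nat M N (f : Hom M N) :
  adj_comp_counit N \oh fmap F (fmap F' (fmap G' (fmap G f)))
    = f \oh adj_comp_counit M.
Proof.
rewrite /adj_comp_counit -hcompA -fmap_comp adj_counit_nat (fmap_comp F).
by rewrite !hcompA adj_counit_nat.
Qed.

Fact adj_comp_triangleF M :
  adj_comp_counit (F (F' M)) \oh fmap F (fmap F' (adj_comp_unit M))
    = hid (F (F' M)).
Proof.
rewrite /adj_comp_counit /adj_comp_unit -hcompA -fmap_comp (fmap_comp F') hcompA.
by rewrite adj_counit_nat -hcompA adj_triangleF hcomph1 adj_triangleF.
Qed.

Fact adj_comp_triangleG M :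
  fmap G' (fmap G (adj_comp_counit M)) \oh adj_comp_unit (G' (G M))
    = hid (G' (G M)).
Proof.
rewrite /adj_comp_counit /adj_comp_unit hcompA -fmap_comp (fmap_comp G).
by rewrite -hcompA -adj_unit_nat hcompA adj_triangleG hcomp1h adj_triangleG.
Qed.

Definition adj_comp : adjunction (F \of F') (G' \of G) :=
  @Adjunction R (F \of F') (G' \of G)
    (@Nattrans R (fid R) ((G' \of G) \of (F \of F'))
       adj_comp_unit adj_comp_unit_nat)
    (@Nattrans R ((F \of F') \of (G' \of G)) (fid R)
       adj_comp_counit adj_comp_counit_nat)
    adj_comp_triangleF adj_comp_triangleG.
End AdjunctionComposition.

Section Mates.
Variables (R : comPzRingType) (F G F' G' : endofunctor R).
Variables (a : adjunction F G) (a' : adjunction F' G') (t : F ~~> F').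

Definition mate_comp (M : lmodType R) : Hom (G' M) (G M) :=
  fmap G (adj_counit a' M) \oh fmap G (t (G' M)) \oh adj_unit a (G' M).

Fact mate_nat (M N : lmodType R) (f : Hom M N) :
  mate_comp N \oh fmap G' f = fmap G f \oh mate_comp M.
Proof.
rewrite /mate_comp -(hcompA _ (adj_unit a _)) adj_unit_nat !hcompA -!fmap_comp.
by rewrite -(hcompA _ (t (G' N))) naturality hcompA adj_counit_nat.
Qed.

(* The mate G' -> G F G' -> G F' G' -> G of t. *)
Definition mate : G' ~~> G := @Nattrans R G' G mate_comp mate_nat.
End Mates.

Record bimonad_data (R : comPzRingType) (X : endofunctor R) := BimonadData {
  bmul : X \of X ~~> X;
  bunit : fid R ~~> X;
  bcomul : X ~~> X \of X;
  bcounit : X ~~> fid R;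
  bdist : X \of X ~~> X \of X }.

Section Bimonads.
Variables (R : comPzRingType) (X : endofunctor R) (D : bimonad_data X).
Local Notation m := (bmul D).
Local Notation e := (bunit D).
Local Notation delta := (bcomul D).
Local Notation eps := (bcounit D).
Local Notation lambda := (bdist D).

(* Equalities of natural transformations are stated at each module M: the
   component at M of t X is t (X M), that of X t is fmap X (t M).  The monad
   and comonad laws are not repeated in is_bimonad_mc and is_bimonad_cm: for
   the structures considered below they follow from those of B. *)

Definition unit_counit_compat : Prop := forall M : lmodType R,
  [/\ eps M \oh e M = hid M,
      eps M \oh m M = eps M \oh fmap X (eps M)
    & delta M \oh e M = e (X M) \oh e M].

(* The suffix mc is for an entwining from the monad to the comonad, cm for one
   from the comonad to the monad. *)
Definition entwining_mc : Prop := forall M : lmodType R,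
  [/\ lambda M \oh e (X M) = fmap X (e M),
      eps (X M) \oh lambda M = fmap X (eps M),
      delta (X M) \oh lambda M
        = fmap X (lambda M) \oh lambda (X M) \oh fmap X (delta M)
    & lambda M \oh m (X M)
        = fmap X (m M) \oh lambda (X M) \oh fmap X (lambda M)].

Definition entwining_cm : Prop := forall M : lmodType R,
  [/\ lambda M \oh fmap X (e M) = e (X M),
      fmap X (eps M) \oh lambda M = eps (X M),
      fmap X (delta M) \oh lambda M
        = lambda (X M) \oh fmap X (lambda M) \oh delta (X M)
    & lambda M \oh fmap X (m M)
        = m (X M) \oh fmap X (lambda M) \oh lambda (X M)].

Definition is_bimonad_mc : Prop :=
  [/\ unit_counit_compat, entwining_mc
    & forall M : lmodType R,
        delta M \oh m M
          = fmap X (m M) \oh lambda (X M) \oh fmap X (delta M)].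

Definition is_bimonad_cm : Prop :=
  [/\ unit_counit_compat, entwining_cm
    & forall M : lmodType R,
        delta M \oh m M
          = m (X M) \oh fmap X (lambda M) \oh delta (X M)].

Definition has_antipode : Prop := exists S : X ~~> X, forall M : lmodType R,
  m M \oh S (X M) \oh delta M = e M \oh eps M /\
  m M \oh fmap X (S M) \oh delta M = e M \oh eps M.
End Bimonads.

Section TensHom.
Variables (R : comPzRingType) (B : lmodType R).
Implicit Types M N P : lmodType R.

Fact tensF_comp M N P (g : Hom N P) (f : Hom M N) :
  tmap (hid B) (g \oh f) = tmap (hid B) g \oh tmap (hid B) f.
Proof. by rewrite -tmap_comp hcomp1h. Qed.

Definition tensF : endofunctor R :=
  @Endofunctor R (fun M => B *t* M) (fun M N f => tmap (hid B) f)
    (@tmap_id R B) tensF_comp.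

Fact postcomp_linear M N (f : Hom M N) :
  linear ((fun h => f \oh h) : homM B M -> homM B N).
Proof. by move=> a g h; apply: hom_ext => x /=; rewrite linearP. Qed.
Definition postcomp M N (f : Hom M N) : Hom (homM B M) (homM B N) :=
  mkHom (postcomp_linear f).

Fact postcomp_id M : postcomp (hid M) = hid (homM B M).
Proof. by apply: hom_ext => f; apply: hom_ext. Qed.
Fact postcomp_comp M N P (g : Hom N P) (f : Hom M N) :
  postcomp (g \oh f) = postcomp g \oh postcomp f.
Proof. by apply: hom_ext => h; apply: hom_ext. Qed.

Definition homF : endofunctor R :=
  @Endofunctor R (homM B) postcomp postcomp_id postcomp_comp.

Fact purer_linear M : linear ((fun x => purer B x) : M -> homM B (B *t* M)).
Proof. by move=> a x y; apply: hom_ext => b /=; rewrite pureTDr pureTZr. Qed.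
(* x |-> (b |-> b (x) x) *)
Definition coev M : Hom M (homM B (B *t* M)) := mkHom (@purer_linear M).

Fact ev_bilinear M : bilinear_map (fun (b : B) (f : homM B M) => (f : Hom B M) b).
Proof. by split=> [b a f g | f a b c] //=; rewrite linearP. Qed.
(* b (x) f |-> f b *)
Definition ev M : Hom (B *t* homM B M) M := tlift (@ev_bilinear M).

Lemma evE M (b : B) (f : Hom B M) : ev M (b ** (f : homM B M)) = f b.
Proof. exact: tliftE. Qed.

Fact coev_nat M N (f : Hom M N) :
  coev N \oh f = postcomp (tmap (hid B) f) \oh coev M.
Proof.
apply: hom_ext => x; apply: hom_ext => b.
by rewrite -[RHS]/(tmap (hid B) f (b ** x)) tmapE.
Qed.
Fact ev_nat M N (f : Hom M N) :
  ev N \oh tmap (hid B) (postcomp f) = f \oh ev M.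
Proof. by apply: tens_ext => b g; rewrite !hcompE tmapE !evE. Qed.
Fact ev_coevF M : ev (B *t* M) \oh tmap (hid B) (coev M) = hid (B *t* M).
Proof. by apply: tens_ext => b x; rewrite !hcompE tmapE evE. Qed.
Fact ev_coevG M : postcomp (ev M) \oh coev (homM B M) = hid (homM B M).
Proof.
by apply: hom_ext => f; apply: hom_ext => b; rewrite -[LHS]/(ev M (b ** f)) evE.
Qed.

Definition tens_hom_adj : adjunction tensF homF :=
  @Adjunction R tensF homF
    (@Nattrans R (fid R) (homF \of tensF) coev coev_nat)
    (@Nattrans R (tensF \of homF) (fid R) ev ev_nat)
    ev_coevF ev_coevG.
End TensHom.

Section InducedData.
Variables (R : comPzRingType) (B : lmodType R).
Variables (A : algebra B) (C : coalgebra B).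
Implicit Types M N : lmodType R.
Local Notation H := (tensF B).
Local Notation T := (homF B).

Definition tens_mul_comp M : Hom (B *t* (B *t* M)) (B *t* M) :=
  tmap (amul A) (hid M) \oh tassoc B B M.
Definition tens_unit_comp M : Hom M (B *t* M) :=
  tmap (aunit A) (hid M) \oh tlunitV M.
Definition tens_comul_comp M : Hom (B *t* M) (B *t* (B *t* M)) :=
  tassocV B B M \oh tmap (ccomul C) (hid M).
Definition tens_counit_comp M : Hom (B *t* M) M :=
  tlunit M \oh tmap (ccounit C) (hid M).
Definition tens_twist_comp M : Hom (B *t* (B *t* M)) (B *t* (B *t* M)) :=
  tassocV B B M \oh tmap (twist B B) (hid M) \oh tassoc B B M.
Definition tens_dist_comp M : Hom (B *t* (B *t* M)) (B *t* (B *t* M)) :=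
  tens_mul_comp (B *t* M) \oh tmap (hid B) (tens_twist_comp M)
    \oh tens_comul_comp (B *t* M).

Fact tens_mul_nat M N (f : Hom M N) :
  tens_mul_comp N \oh tmap (hid B) (tmap (hid B) f)
    = tmap (hid B) f \oh tens_mul_comp M.
Proof.
by rewrite /tens_mul_comp -hcompA tassoc_nat !hcompA tmap_id tmap_exch.
Qed.
Fact tens_unit_nat M N (f : Hom M N) :
  tens_unit_comp N \oh f = tmap (hid B) f \oh tens_unit_comp M.
Proof. by rewrite /tens_unit_comp -hcompA tlunitV_nat !hcompA tmap_exch. Qed.
Fact tens_comul_nat M N (f : Hom M N) :
  tens_comul_comp N \oh tmap (hid B) f
    = tmap (hid B) (tmap (hid B) f) \oh tens_comul_comp M.
Proof.
by rewrite /tens_comul_comp -hcompA tmap_exch !hcompA -tassocV_nat tmap_id.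
Qed.
Fact tens_counit_nat M N (f : Hom M N) :
  tens_counit_comp N \oh tmap (hid B) f = f \oh tens_counit_comp M.
Proof. by rewrite /tens_counit_comp -hcompA tmap_exch !hcompA tlunit_nat. Qed.
Fact tens_twist_nat M N (f : Hom M N) :
  tens_twist_comp N \oh tmap (hid B) (tmap (hid B) f)
    = tmap (hid B) (tmap (hid B) f) \oh tens_twist_comp M.
Proof.
rewrite /tens_twist_comp -hcompA tassoc_nat tmap_id !hcompA.
by rewrite -tassocV_nat -!(hcompA (tassocV _ _ _)) tmap_id tmap_exch.
Qed.
Fact tens_dist_nat M N (f : Hom M N) :
  tens_dist_comp N \oh tmap (hid B) (tmap (hid B) f)
    = tmap (hid B) (tmap (hid B) f) \oh tens_dist_comp M.
Proof.
rewrite /tens_dist_comp -hcompA tens_comul_nat -hcompA (hcompA (tmap _ _)).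
rewrite -tensF_comp tens_twist_nat tensF_comp !hcompA tens_mul_nat.
by rewrite /tens_mul_comp !hcompA.
Qed.

(* The structure on H = B (x) -: m (x) -, e (x) -, delta (x) -, eps (x) - and
   (m H) . (H tau) . (delta H). *)
Definition tens_data : bimonad_data H := @BimonadData R H
  (@Nattrans R (H \of H) H tens_mul_comp tens_mul_nat)
  (@Nattrans R (fid R) H tens_unit_comp tens_unit_nat)
  (@Nattrans R H (H \of H) tens_comul_comp tens_comul_nat)
  (@Nattrans R H (fid R) tens_counit_comp tens_counit_nat)
  (@Nattrans R (H \of H) (H \of H) tens_dist_comp tens_dist_nat).

Let adj0 := adj_id R.
Let adj1 := tens_hom_adj B.
Let adj2 := adj_comp (tens_hom_adj B) (tens_hom_adj B).

Definition hom_data : bimonad_data T := @BimonadData R T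
  (mate adj1 adj2 (bcomul tens_data))
  (mate adj1 adj0 (bcounit tens_data))
  (mate adj2 adj1 (bmul tens_data))
  (mate adj0 adj1 (bunit tens_data))
  (mate adj2 adj2 (bdist tens_data)).
End InducedData.

Definition finitely_generated (R : comPzRingType) (M : lmodType R) : Prop :=
  exists (n : nat) (b : 'I_n -> M), forall x : M,
    exists c : 'I_n -> R, x = \sum_i c i *: b i.

Definition projective (R : comPzRingType) (P : lmodType R) : Prop :=
  forall (M N : lmodType R) (p : Hom M N) (f : Hom P N),
    (forall y : N, exists x : M, p x = y) -> exists g : Hom P M, p \oh g = f.

Definition fg_projective (R : comPzRingType) (M : lmodType R) : Prop :=
  finitely_generated M /\ projective M.

Section Dual.
Variable R : comPzRingType.
Implicit Types M N : lmodType R.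

Definition dual M : lmodType R := homM M (regM R).

Fact precomp_linear M N (f : Hom M N) :
  linear ((fun h => (h : Hom N (regM R)) \oh f) : dual N -> dual M).
Proof. by move=> a g h; apply: hom_ext. Qed.
Definition dual_map M N (f : Hom M N) : Hom (dual N) (dual M) :=
  mkHom (precomp_linear f).

Fact kappa_subproof M N : bilinear_map
  (fun (f : dual M) (g : dual N) =>
     (tlunit (regM R) \oh tmap (f : Hom _ _) (g : Hom _ _)) : dual (M *t* N)).
Proof.
split=> [f a g g' | g a f f']; apply: tens_ext => x y; rewrite homD homZ.
  by rewrite !hcompE !tmapE !tlunitE linearP.
rewrite !hcompE !tmapE !tlunitE homD homZ scalerDl; congr (_ + _).
by rewrite -scalerA.
Qed.
Lemma dual_map_comp M N P (g : Hom N P) (f : Hom M N) :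
  dual_map (g \oh f) = dual_map f \oh dual_map g.
Proof. by apply: hom_ext => h; apply: hom_ext. Qed.
Lemma dual_map_id M : dual_map (hid M) = hid (dual M).
Proof. by apply: hom_ext => h; apply: hom_ext. Qed.

(* f (x) g |-> (x (x) y |-> f x * g y) *)
Definition kappa M N : Hom (dual M *t* dual N) (dual (M *t* N)) :=
  tlift (@kappa_subproof M N).

Fact evd_linear M (x : M) :
  linear ((fun f => (f : Hom M (regM R)) x) : dual M -> regM R).
Proof. by []. Qed.
Definition evd M (x : M) : Hom (dual M) (regM R) := mkHom (evd_linear x).

Lemma evdE M (x : M) (f : Hom M (regM R)) : evd x (f : dual M) = f x.
Proof. by []. Qed.

Lemma dual_ext M (f g : dual M) : (forall x, evd x f = evd x g) -> f = g.
Proof. by move=> fg; apply: hom_ext => x; apply: fg. Qed.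

Lemma evdP M a (x y : M) f : evd (a *: x + y) f = a *: evd x f + evd y f.
Proof. exact: (linearP (f : Hom M (regM R))). Qed.

Lemma kappaE M N (f : dual M) (g : dual N) (x : M) (y : N) :
  evd (x ** y) (kappa M N (f ** g)) = (evd x f : R) * evd y g.
Proof.
rewrite /kappa tliftE.
by rewrite -[LHS]/((tlunit (regM R) \oh tmap (f : Hom M _) (g : Hom N _)) (x ** y))
  hcompE tmapE tlunitE.
Qed.

Lemma dual_tens_ext M N (f g : dual (M *t* N)) :
  (forall x y, evd (x ** y) f = evd (x ** y) g) -> f = g.
Proof. exact: tens_ext. Qed.

Lemma dual_tens_ext3V M N P (f g : dual (M *t* N *t* P)) :
  (forall x y z, evd (x ** y ** z) f = evd (x ** y ** z) g) -> f = g.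
Proof. exact: tens_ext3V. Qed.

Lemma evd_map M N (f : Hom M N) (x : M) (h : dual N) :
  evd x (dual_map f h) = evd (f x) h.
Proof. by []. Qed.

Lemma kappa_nat M N M' N' (f : Hom M M') (g : Hom N N') :
  kappa M N \oh tmap (dual_map f) (dual_map g)
    = dual_map (tmap f g) \oh kappa M' N'.
Proof.
apply: tens_ext => h k; apply: dual_tens_ext => x y.
by rewrite !hcompE tmapE evd_map tmapE !kappaE !evd_map.
Qed.

Lemma kappa_assoc M N P :
  kappa (M *t* N) P \oh tmap (kappa M N) (hid _) \oh tassoc _ _ _
    = dual_map (tassocV M N P) \oh kappa M (N *t* P)
        \oh tmap (hid _) (kappa N P).
Proof.
apply: tens_ext3 => f g h; apply: dual_tens_ext3V => x y z.
by rewrite !hcompE evd_map tassocE tassocVE !tmapE !kappaE mulrA.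
Qed.

Lemma dual_basis N : fg_projective N ->
  exists (n : nat) (b : 'I_n -> N) (nu : 'I_n -> dual N),
    forall y : N, y = \sum_i (evd y (nu i) : R) *: b i.
Proof.
move=> [[n [b bgen]] projN]; pose V : lmodType R := 'rV[R]_n.
have plin : linear ((fun v => \sum_i v 0 i *: b i) : V -> N).
  move=> a u v; rewrite scaler_sumr -big_split; apply: eq_bigr => i _ /=.
  by rewrite !mxE scalerDl scalerA.
have clin i : linear ((fun v => v 0 i) : V -> regM R).
  by move=> a u v; rewrite !mxE.
have [|s ps] := projN _ _ (mkHom plin) (hid N).
  move=> y; have [c ->] := bgen y; exists (\row_i c i).
  by apply: eq_bigr => i _; rewrite mxE.
exists n, b, (fun i => mkHom (clin i) \oh s : dual N) => y.
by have /(congr1 (fun h : Hom N N => h y)) := ps.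
Qed.

Lemma kappa_iso M N : fg_projective N ->
  exists k : Hom (dual (M *t* N)) (dual M *t* dual N),
    kappa M N \oh k = hid _ /\ k \oh kappa M N = hid _.
Proof.
move=> /dual_basis [n [b [nu bnu]]].
have klin : linear ((fun phi =>
    \sum_i dual_map (purer M (b i)) phi ** nu i)
    : dual (M *t* N) -> dual M *t* dual N).
  move=> a u v; rewrite scaler_sumr -big_split; apply: eq_bigr => i _.
  by rewrite linearP pureTDl pureTZl.
exists (mkHom klin); split.
  apply: hom_ext => phi; rewrite hcompE.
  rewrite -[mkHom klin phi]/(\sum_i dual_map (purer M (b i)) phi ** nu i).
  rewrite linear_sum; apply: tens_ext => x y.
  rewrite -[LHS]/(evd (x ** y) (\sum_i _)) linear_sum.
  under eq_bigr => i _ do rewrite kappaE mulrC.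
  rewrite [in RHS](bnu y) -[RHS]/(phi (pureT x _)).
  rewrite -[x ** _]/(purel N x _) !linear_sum; apply: eq_bigr => i _.
  by rewrite !linearZ_LR.
apply: tens_ext => f g; rewrite hcompE.
rewrite -[mkHom klin _]/(\sum_i dual_map (purer M (b i)) _ ** nu i).
have E : f ** g = f ** (\sum_i (evd (b i) g : R) *: nu i).
  congr (_ ** _); apply: dual_ext => y; rewrite linear_sum [in LHS](bnu y).
  rewrite -[LHS]/((g : Hom _ _) (\sum_i _)) linear_sum; apply: eq_bigr => i _.
  by rewrite [LHS]linearZ_LR [RHS]linearZ_LR; apply: (mulrC (_ : R)).
rewrite -[RHS]/(f ** g) [RHS]E.
rewrite -[RHS]/(purel _ f (\sum_i _)) linear_sum; apply: eq_bigr => i _.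
rewrite linearZ_LR -pureTZl; congr (_ ** _); apply: dual_ext => x.
rewrite -[LHS]/(evd (x ** b i) (kappa M N _)).
by rewrite kappaE linearZ_LR mulrC.
Qed.

Definition kappa_inv M N (hN : fg_projective N) :
    Hom (dual (M *t* N)) (dual M *t* dual N) :=
  sval (cid (@kappa_iso M N hN)).

Lemma kappa_invK M N hN : kappa M N \oh kappa_inv M hN = hid _.
Proof. by rewrite /kappa_inv; case: cid => k []. Qed.
Lemma kappaK M N hN : kappa_inv M hN \oh kappa M N = hid _.
Proof. by rewrite /kappa_inv; case: cid => k []. Qed.

Lemma kappa_inj M N (hN : fg_projective N) (s t : dual M *t* dual N) :
  kappa M N s = kappa M N t -> s = t.
Proof.
move=> st; rewrite -[s]/(hid _ s) -[t]/(hid _ t) -(kappaK M hN) !hcompE.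
by rewrite st.
Qed.
End Dual.

Section DualStructures.
Variables (R : comPzRingType) (B : lmodType R).
Local Notation kappaBB := (kappa B B).

Section DualAlgebra.
Variable C : coalgebra B.

(* f * g = (f (x) g) . delta *)
Definition dual_mul : Hom (dual B *t* dual B) (dual B) :=
  dual_map (ccomul C) \oh kappaBB.
Fact dual_unit_linear :
  linear ((fun a => (a : R) *: (ccounit C : dual B)) : regM R -> dual B).
Proof. by move=> a b c; rewrite scalerDl -scalerA. Qed.
Definition dual_unit : Hom (regM R) (dual B) := mkHom dual_unit_linear.

Fact dual_mulA : dual_mul \oh tmap dual_mul (hid (dual B)) \oh tassoc _ _ _
  = dual_mul \oh tmap (hid (dual B)) dual_mul.
Proof.
pose dB := dual B; pose d := ccomul C.
have El : dual_mul \oh tmap dual_mul (hid dB)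
    = dual_map (tmap d (hid B) \oh d) \oh kappa _ _ \oh tmap kappaBB (hid dB).
  have -> : tmap dual_mul (hid dB)
      = tmap (dual_map d) (dual_map (hid B)) \oh tmap kappaBB (hid dB).
    by rewrite -tmap_comp dual_map_id hcomp1h.
  by rewrite /dual_mul hcompA -(hcompA _ kappaBB) kappa_nat dual_map_comp !hcompA.
have Er : dual_mul \oh tmap (hid dB) dual_mul
    = dual_map (tmap (hid B) d \oh d) \oh kappa _ _ \oh tmap (hid dB) kappaBB.
  have -> : tmap (hid dB) dual_mul
      = tmap (dual_map (hid B)) (dual_map d) \oh tmap (hid dB) kappaBB.
    by rewrite -tmap_comp dual_map_id hcomp1h.
  by rewrite /dual_mul hcompA -(hcompA _ kappaBB) kappa_nat dual_map_comp !hcompA.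
rewrite El Er -!hcompA (hcompA (kappa _ _)) kappa_assoc !hcompA -dual_map_comp.
by rewrite ccomulA !hcompA tassocVK hcomp1h.
Qed.
Fact dual_mul1l :
  dual_mul \oh tmap dual_unit (hid (dual B)) \oh tlunitV (dual B) = hid _.
Proof.
apply: hom_ext => f; apply: dual_ext => x; rewrite !hcompE evd_map tmapE.
rewrite -[RHS]/((f : Hom _ _) (hid B x)) -(ccounitl C) !hcompE.
set t := ccomul C x; rewrite -[RHS]/(evd t ((f : Hom _ _) \oh tlunit B \oh tmap (ccounit C) (hid B))).
congr (evd t _); apply: dual_tens_ext => y z.
by rewrite kappaE [RHS]evdE !hcompE tmapE tlunitE [RHS]linearZ_LR linearZ_LR scale1r.
Qed.
Fact dual_mul1r :
  dual_mul \oh tmap (hid (dual B)) dual_unit \oh trunitV (dual B) = hid _.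
Proof.
apply: hom_ext => f; apply: dual_ext => x; rewrite !hcompE evd_map tmapE.
rewrite -[RHS]/((f : Hom _ _) (hid B x)) -(ccounitr C) !hcompE.
set t := ccomul C x; rewrite -[RHS]/(evd t ((f : Hom _ _) \oh trunit B \oh tmap (hid B) (ccounit C))).
congr (evd t _); apply: dual_tens_ext => y z.
by rewrite kappaE [RHS]evdE !hcompE tmapE trunitE [RHS]linearZ_LR linearZ_LR scale1r mulrC.
Qed.

Definition dual_algebra : algebra (dual B) :=
  Algebra dual_mulA dual_mul1l dual_mul1r.
End DualAlgebra.

Section DualCoalgebra.
Variables (A : algebra B) (hB : fg_projective B).

(* f |-> f . m, seen in dual B (x) dual B through kappa *)
Definition dual_comul : Hom (dual B) (dual B *t* dual B) :=
  kappa_inv B hB \oh dual_map (amul A).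
Definition dual_counit : Hom (dual B) (regM R) := evd (aunit A (1 : R)).

Fact dual_comulA : tmap dual_comul (hid (dual B)) \oh dual_comul
  = tassoc _ _ _ \oh tmap (hid (dual B)) dual_comul \oh dual_comul.
Proof.
pose dB := dual B; pose c := dual_comul; pose m := amul A.
have kc : kappaBB \oh c = dual_map m by rewrite hcompA kappa_invK hcomp1h.
pose k3 := kappa (B *t* B) B \oh tmap kappaBB (hid dB).
have k3l : k3 \oh (tmap c (hid dB) \oh c) = dual_map (m \oh tmap m (hid B)).
  rewrite /k3 -hcompA (hcompA (tmap kappaBB _)) -tmap_comp kc hcomp1h.
  by rewrite -(dual_map_id B) hcompA kappa_nat -hcompA kc -dual_map_comp.
have k3r : k3 \oh (tassoc _ _ _ \oh tmap (hid dB) c \oh c)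
    = dual_map (m \oh tmap (hid B) m \oh tassocV B B B).
  rewrite /k3 !hcompA kappa_assoc -!hcompA (hcompA (tmap _ kappaBB)).
  rewrite -tmap_comp kc hcomp1h -(dual_map_id B) (hcompA (kappa _ _)) kappa_nat.
  by rewrite -hcompA kc -!dual_map_comp !hcompA.
have k3i : tmap (kappa_inv B hB) (hid dB) \oh kappa_inv _ hB \oh k3 = hid _.
  rewrite /k3 hcompA -(hcompA _ (kappa_inv _ _)) kappaK hcomph1 -tmap_comp.
  by rewrite kappaK hcomp1h tmap_id.
rewrite -[LHS]hcomp1h -[RHS]hcomp1h -k3i -[LHS]hcompA -[RHS]hcompA k3l k3r.
by rewrite -amulA -(hcompA _ (tassoc _ _ _)) tassocK hcomph1.
Qed.
Fact dual_counitl :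
  tlunit (dual B) \oh tmap dual_counit (hid (dual B)) \oh dual_comul = hid _.
Proof.
have -> : tlunit (dual B) \oh tmap dual_counit (hid (dual B))
    = dual_map (tmap (aunit A) (hid B) \oh tlunitV B) \oh kappaBB.
  apply: tens_ext => f g; apply: dual_ext => x.
  by rewrite !hcompE tmapE tlunitE evd_map hcompE tmapE kappaE linearZ_LR.
rewrite /dual_comul -hcompA (hcompA kappaBB) kappa_invK hcomp1h.
by rewrite -dual_map_comp hcompA amul1l dual_map_id.
Qed.
Fact dual_counitr :
  trunit (dual B) \oh tmap (hid (dual B)) dual_counit \oh dual_comul = hid _.
Proof.
have -> : trunit (dual B) \oh tmap (hid (dual B)) dual_counit
    = dual_map (tmap (hid B) (aunit A) \oh trunitV B) \oh kappaBB.
  apply: tens_ext => f g; apply: dual_ext => x.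
  by rewrite !hcompE tmapE trunitE evd_map hcompE tmapE kappaE linearZ_LR mulrC.
rewrite /dual_comul -hcompA (hcompA kappaBB) kappa_invK hcomp1h.
by rewrite -dual_map_comp hcompA amul1r dual_map_id.
Qed.

Definition dual_coalgebra : coalgebra (dual B) :=
  Coalgebra dual_comulA dual_counitl dual_counitr.
End DualCoalgebra.
End DualStructures.

(* Main.v *)
Require Import Defs.
From HB Require Import structures.
From mathcomp Require Import all_boot all_order all_algebra.
Import Defs.

Set Implicit Arguments.
Unset Strict Implicit.
Unset Printing Implicit Defensive.

Import GRing.Theory.
Local Open Scope ring_scope.

(** All three equivalences transport a list of equations along a faithful
    passage, so that each equation on one side matches one on the other.

    For the functor H = B (x) -, every structure map at a module M sends
    b (x) c (x) x to an element obtained by computing in B and carrying x along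
    unchanged.  At M = R an equation between such maps is the equation in B, and
    conversely the equation in B gives the one at every M.  In this way the
    multiplicativity and unit axioms of a bialgebra are the unit-counit
    equations and the equation for delta . m (bialgebra_bimonad,
    bimonad_bialgebra); the entwining equations for
    b (x) c |-> b1 c (x) b2 are then consequences, by (co)associativity, the
    unit and counit laws and the multiplicativity of delta and eps.  A natural
    transformation from H to itself is S (x) - for a unique endomorphism S of B,
    because any element x of M is the image of 1 under a map from R to M; hence
    antipodes correspond (tens_antipode).

    For the right adjoint T = Hom(B, -), taking mates is a bijection which
    reverses composition and exchanges the two whiskerings: the mate of H t is
    s T and the mate of t H is T s, where s is the mate of t.  Applied to both
    sides of an axiom of H, this yields exactly an axiom of T
    (is_bimonad_mate, has_antipode_mate); this part holds for every adjunction.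

    When B is finitely generated projective, the linear forms separate the
    points of B and of B (x) B, every endomorphism of the dual of B is a
    transpose, and B* (x) B* is the dual of B (x) B.  Each axiom for B*,
    evaluated on elements of B, is then the dual axiom for B paired with forms:
    multiplicativity of delta is self-dual, compatibility of eps with m
    is exchanged with compatibility of delta with e, and the antipode is
    transposed (dual_hopf). *)

(** * Tensors and maps out of the ground ring *)

Lemma pureT0l (R : comPzRingType) (M N : lmodType R) (y : N) :
  (0 : M) ** y = 0.
Proof. by rewrite -[0 ** y]/(purer M y 0) linear0. Qed.

Lemma pureT0r (R : comPzRingType) (M N : lmodType R) (x : M) :
  x ** (0 : N) = 0.
Proof. by rewrite -[x ** 0]/(purel N x 0) linear0. Qed.

(** Compared with tens_ext, this also applies to expressions in a tensor that
    are additive without being given as a linear map. *)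
Lemma tens_ind (R : comPzRingType) (M N : lmodType R) (P : M *t* N -> Prop) :
  P 0 -> (forall t u, P t -> P u -> P (t + u)) -> (forall x y, P (x ** y)) ->
  forall t, P t.
Proof.
move=> P0 PD Pp t; rewrite (tensE t).
by elim/big_ind: _ => // p _; apply: Pp.
Qed.

Lemma hom_app (R : comPzRingType) (M N : lmodType R) (f g : Hom M N) x :
  f = g -> f x = g x.
Proof. by move->. Qed.

Lemma middle_twistE (R : comPzRingType) (B : lmodType R) (a b c d : B) :
  middle_twist B (a ** b ** (c ** d)) = a ** c ** (b ** d).
Proof.
rewrite /middle_twist !hcompE tassocVE tmapE !hcompE tassocE tmapE twistE.
by rewrite tassocVE tassocE.
Qed.

Lemma tassocV_purer (R : comPzRingType) (M N P : lmodType R) (t : M *t* N) (y : P) :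
  tassocV M N P (t ** y) = tmap (hid M) (purer N y) t.
Proof. exact: tliftE. Qed.

Lemma regM_homE (R : comPzRingType) (N : lmodType R) (f : Hom (regM R) N)
  (a : regM R) : f a = (a : R) *: f (1 : R).
Proof. by rewrite -linearZ_LR; congr (f _); rewrite /GRing.scale /= mulr1. Qed.

Lemma regM_ext (R : comPzRingType) (N : lmodType R) (f g : Hom (regM R) N) :
  f (1 : R) = g (1 : R) -> f = g.
Proof. by move=> fg; apply: hom_ext => a; rewrite regM_homE fg -regM_homE. Qed.

Lemma purer1_inj (R : comPzRingType) (M N : lmodType R) (s t : M *t* N) :
  tmap (hid M) (purer N (1 : regM R)) s = tmap (hid M) (purer N (1 : regM R)) t ->
  s = t.
Proof.
have K : tmap (hid M) (trunit N) \oh tmap (hid M) (purer N (1 : regM R)) = hid _.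
  by apply: tens_ext => x y; rewrite hcompE !tmapE trunitE scale1r.
by move=> st; rewrite -[s]/(hid _ s) -[t]/(hid _ t) -K !hcompE st.
Qed.

Lemma pureT1_inj (R : comPzRingType) (M : lmodType R) (x y : M) :
  x ** (1 : regM R) = y ** (1 : regM R) -> x = y.
Proof. by move/(congr1 (trunit M)); rewrite !trunitE !scale1r. Qed.

(** * The functor given by tensoring with B *)

Section TensMonad.
Variables (R : comPzRingType) (B : lmodType R).
Variables (A : algebra B) (C : coalgebra B).
Implicit Types M N : lmodType R.
Local Notation H := (tensF B).
Local Notation D := (tens_data A C).
Local Notation m := (amul A).
Local Notation e := (aunit A).
Local Notation delta := (ccomul C).
Local Notation eps := (ccounit C).

Local Notation mulH := (tens_mul_comp A).
Local Notation unitH := (tens_unit_comp A).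
Local Notation comulH := (tens_comul_comp C).
Local Notation counitH := (tens_counit_comp C).
Local Notation distH := (tens_dist_comp A C).

Lemma tens_mulE M (b c : B) (x : M) : mulH M (b ** (c ** x)) = m (b ** c) ** x.
Proof. by rewrite [LHS]hcompE tassocE tmapE. Qed.

Lemma tens_unitE M (x : M) : unitH M x = e (1 : R) ** x.
Proof. by rewrite [LHS]hcompE tmapE. Qed.

Lemma tens_comulE M (b : B) (x : M) :
  comulH M (b ** x) = tmap (hid B) (purer B x) (delta b).
Proof.
rewrite [LHS]hcompE tmapE; elim/tens_ind: (delta b) => [|t u Et Eu|c d].
- by rewrite pureT0l !linear0.
- by rewrite pureTDl !linearD Et Eu.
- by rewrite tassocVE tmapE.
Qed.

Lemma tens_counitE M (b : B) (x : M) :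
  counitH M (b ** x) = (eps b : R) *: x.
Proof. by rewrite [LHS]hcompE tmapE tlunitE. Qed.

Fact mulr_linear (c : B) : linear (fun b => m (b ** c)).
Proof. by move=> a b b'; rewrite pureTDl pureTZl linearP. Qed.
Definition mulr_by (c : B) : Hom B B := mkHom (mulr_linear c).

(** In Sweedler notation, b (x) c (x) x goes to b1 c (x) b2 (x) x. *)
Lemma tens_distE M (b c : B) (x : M) :
  distH M (b ** (c ** x)) = tmap (mulr_by c) (purer B x) (delta b).
Proof.
rewrite -[LHS]/((mulH (B *t* M) \oh tmap (hid B) (tens_twist_comp B M)
  \oh comulH (B *t* M)) (b ** (c ** x))).
rewrite hcompE [comulH _ _]tens_comulE.
elim/tens_ind: (delta b) => [|t u Et Eu|p q].
- by rewrite !linear0.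
- by rewrite !linearD Et Eu.
by rewrite hcompE !tmapE !hcompE tassocE tmapE twistE tassocVE tassocE tmapE.
Qed.

(* From here on the structure maps are used only through their values on pure
   tensors. *)
#[local] Opaque tens_mul_comp tens_unit_comp tens_comul_comp tens_counit_comp
  tens_dist_comp.

(* The multiplication of the algebra B (x) B. *)
Local Notation mul2 := (tmap m m \oh middle_twist B).

Lemma mul2E (b c b' c' : B) :
  mul2 (b ** c ** (b' ** c')) = m (b ** b') ** m (c ** c').
Proof. by rewrite hcompE middle_twistE tmapE. Qed.

(** The right-hand side of the bimonad equation for delta . m at M is the
    right-hand side of the bialgebra equation with x appended; this serves both
    implications between the two. *)
Lemma tens_mul_comulE M (b c : B) (x : M) :
  tmap (hid B) (mulH M) (distH (B *t* M) (tmap (hid B) (comulH M) (b ** (c ** x))))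
    = tmap (hid B) (purer B x) (mul2 (delta b ** delta c)).
Proof.
rewrite tmapE tens_comulE.
elim/tens_ind: (delta c) => [|t u Et Eu|c1 c2].
- by rewrite pureT0r !linear0 pureT0r !linear0.
- by rewrite pureTDr !linearD pureTDr !linearD Et Eu.
rewrite tmapE tens_distE.
elim/tens_ind: (delta b) => [|t u Et Eu|b1 b2].
- by rewrite pureT0l !linear0.
- by rewrite pureTDl !linearD Et Eu.
by rewrite mul2E !tmapE tens_mulE.
Qed.

Lemma mul_assocE (a b c : B) : m (m (a ** b) ** c) = m (a ** m (b ** c)).
Proof.
have /(congr1 (fun f : Hom _ _ => f (a ** (b ** c)))) := amulA A.
by rewrite !hcompE tassocE !tmapE.
Qed.
Lemma mul_1lE (b : B) : m (e (1 : R) ** b) = b.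
Proof.
have /(congr1 (fun f : Hom B B => f b)) := amul1l A.
by rewrite !hcompE tmapE.
Qed.
Lemma comul_assocE (b : B) :
  tassocV B B B (tmap delta (hid B) (delta b)) = tmap (hid B) delta (delta b).
Proof.
have /(congr1 (fun f : Hom _ _ => tassocV B B B (f b))) := ccomulA C.
by rewrite !hcompE => ->; rewrite -[LHS]/((tassocV _ _ _ \oh tassoc _ _ _) _) tassocVK.
Qed.
Lemma counit_lE (b : B) : tlunit B (tmap eps (hid B) (delta b)) = b.
Proof. by have /(congr1 (fun f : Hom B B => f b)) := ccounitl C. Qed.

(** The equations are read off in generic M, and only then at M = R and x = 1,
    where appending x is injective. *)
Lemma bimonad_bialgebra : is_bimonad_mc D -> is_bialgebra A C.
Proof.
move=> [h1 _ h3].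
have h3' M b c (x : M) : tmap (hid B) (purer B x) (delta (m (b ** c)))
    = tmap (hid B) (purer B x) (mul2 (delta b ** delta c)).
  rewrite -tens_mul_comulE -tens_comulE -tens_mulE.
  exact: (hom_app (b ** (c ** x)) (h3 M)).
have ee M (x : M) : (eps (e (1 : R)) : R) *: x = x.
  rewrite -tens_counitE -tens_unitE.
  have E : counitH M \oh unitH M = hid M by have [] := h1 M.
  exact: (hom_app x E).
have em M b c (x : M) :
    (eps (m (b ** c)) : R) *: x = (eps b : R) *: ((eps c : R) *: x).
  rewrite -!tens_counitE -tens_mulE.
  have E : counitH M \oh mulH M = counitH M \oh tmap (hid B) (counitH M).
    by have [] := h1 M.
  by have := hom_app (b ** (c ** x)) E; rewrite !hcompE tmapE.
have de M (x : M) : tmap (hid B) (purer B x) (delta (e (1 : R)))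
    = tmap (hid B) (purer B x) (e (1 : R) ** e (1 : R)).
  have /(hom_app x) d : comulH M \oh unitH M = unitH (B *t* M) \oh unitH M.
    by have [] := h1 M.
  rewrite (hcompE (comulH M)) (hcompE (unitH _)) !tens_unitE in d.
  by rewrite tens_comulE in d; rewrite d tmapE.
split.
- apply: tens_ext => b c; rewrite !hcompE tmapE.
  by apply: purer1_inj; rewrite h3' hcompE.
- by apply: regM_ext; rewrite !hcompE tmapE; apply: purer1_inj.
- apply: tens_ext => b c; rewrite !hcompE tmapE tlunitE.
  by have := em (regM R) b c 1; rewrite /GRing.scale /= !mulr1.
apply: regM_ext; rewrite hcompE.
by have := ee (regM R) 1; rewrite /GRing.scale /= !mulr1.
Qed.

Section FromBialgebra.
Hypothesis AC : is_bialgebra A C.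

Lemma comul_mulE (b c : B) : delta (m (b ** c)) = mul2 (delta b ** delta c).
Proof.
have [/(hom_app (b ** c)) E _ _ _] := AC.
by rewrite -[LHS]/((delta \oh m) (b ** c)) E hcompE tmapE.
Qed.
Lemma comul_1E : delta (e (1 : R)) = e (1 : R) ** e (1 : R).
Proof.
have [_ /(hom_app (1 : regM R)) E _ _] := AC.
by rewrite -[LHS]/((delta \oh e) (1 : R)) E !hcompE tmapE.
Qed.
Lemma counit_mulE (b c : B) : eps (m (b ** c)) = (eps b : R) * eps c.
Proof.
have [_ _ /(hom_app (b ** c)) E _] := AC.
by rewrite -[LHS]/((eps \oh m) (b ** c)) E hcompE tmapE tlunitE.
Qed.
Lemma counit_1E : eps (e (1 : R)) = (1 : R).
Proof. by have [_ _ _ /(hom_app (1 : regM R))] := AC. Qed.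

Lemma bialgebra_unit_counit : unit_counit_compat D.
Proof.
split.
- apply: hom_ext => x; rewrite [LHS]hcompE tens_unitE.
  by rewrite tens_counitE counit_1E scale1r.
- apply: tens_ext3 => b c x.
  rewrite [LHS]hcompE [RHS]hcompE tens_mulE tmapE !tens_counitE.
  by rewrite counit_mulE scalerA.
apply: hom_ext => x.
by rewrite [LHS]hcompE [RHS]hcompE !tens_unitE tens_comulE comul_1E tmapE.
Qed.

Lemma bialgebra_dist_unit M : distH M \oh unitH (B *t* M) = tmap (hid B) (unitH M).
Proof.
apply: tens_ext => c x; rewrite [LHS]hcompE tens_unitE tens_distE comul_1E.
by rewrite [RHS]tmapE tmapE tens_unitE -[mulr_by _ _]/(m (_ ** _)) mul_1lE.
Qed.

Lemma bialgebra_dist_counit M :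
  counitH (B *t* M) \oh distH M = tmap (hid B) (counitH M).
Proof.
apply: tens_ext3 => b c x; rewrite [LHS]hcompE tens_distE [RHS]tmapE tens_counitE.
transitivity ((eps c : R) *: (tlunit B (tmap eps (hid B) (delta b)) ** x));
  last by rewrite counit_lE pureTZr.
elim/tens_ind: (delta b) => [|t u Et Eu|b1 b2].
- by rewrite !linear0 pureT0l scaler0.
- by rewrite !linearD pureTDl scalerDr Et Eu.
rewrite !tmapE tens_counitE tlunitE counit_mulE mulrC.
by rewrite pureTZl scalerA.
Qed.

(* For u = c1 (x) c2 this is the map
   b1 (x) (b2 (x) b3) |-> b1 c1 (x) b2 c2 (x) b3 (x) x; at u = delta c and the
   iterated coproduct of b it is the common value of the two sides of
   bialgebra_dist_comul. *)
Let comul3 M (u : B *t* B) (x : M) : Hom (B *t* (B *t* B)) (B *t* (B *t* (B *t* M))) :=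
  tassocV B B (B *t* M) \oh tmap (mul2 \oh purer _ u) (purer B x)
  \oh tassoc B B B.

Let comul3E M u (x : M) p q r :
  comul3 u x (p ** (q ** r)) = tassocV B B (B *t* M) (mul2 (p ** q ** u) ** (r ** x)).
Proof. by rewrite /comul3 !hcompE tassocE tmapE. Qed.

Let comul3_0 M (x : M) w : comul3 0 x w = 0.
Proof.
suff -> : comul3 0 x = 0 by [].
apply: tens_ext3 => p q r; rewrite comul3E.
by rewrite pureT0r linear0 pureT0l linear0.
Qed.

Let comul3_D M (x : M) u v w : comul3 (u + v) x w = comul3 u x w + comul3 v x w.
Proof.
suff -> : comul3 (u + v) x = comul3 u x + comul3 v x by [].
apply: tens_ext3 => p q r; rewrite homD !comul3E.
by rewrite pureTDr linearD pureTDl linearD.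
Qed.

(** Both sides are b1 c1 (x) b2 c2 (x) b3 (x) x.  The left side arises with
    delta applied to the first factor of delta b, the right side with delta
    applied to the second; coassociativity identifies them. *)
Lemma bialgebra_dist_comul M :
  comulH (B *t* M) \oh distH M
    = tmap (hid B) (distH M) \oh distH (B *t* M) \oh tmap (hid B) (comulH M).
Proof.
apply: tens_ext3 => b c x.
transitivity (comul3 (delta c) x (tmap (hid B) delta (delta b))).
  rewrite [LHS]hcompE tens_distE -comul_assocE.
  elim/tens_ind: (delta b) => [|t u Et Eu|b1 b2].
  - by rewrite !linear0.
  - by rewrite !linearD Et Eu.
  rewrite !tmapE [comulH _ _]tens_comulE comul_mulE.
  elim/tens_ind: (delta b1) => [|t u Et Eu|p q].
  - by rewrite !(pureT0l, linear0).
  - by rewrite !(pureTDl, linearD) Et Eu.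
  by rewrite tassocVE comul3E tassocV_purer.
rewrite (hcompE (tmap (hid B) (distH M) \oh distH (B *t* M)) (tmap (hid B) (comulH M))).
rewrite (hcompE (tmap (hid B) (distH M)) (distH (B *t* M))).
rewrite (tmapE (hid B) (comulH M)) tens_comulE.
elim/tens_ind: (delta c) => [|t u Et Eu|c1 c2].
- by rewrite comul3_0 !(pureT0r, linear0).
- by rewrite comul3_D !linearD pureTDr !linearD Et Eu.
rewrite tmapE tens_distE.
elim/tens_ind: (delta b) => [|t u Et Eu|b1 b2].
- by rewrite !linear0.
- by rewrite !linearD Et Eu.
rewrite !tmapE tens_distE.
elim/tens_ind: (delta b2) => [|t u Et Eu|p q].
- by rewrite !(pureT0r, linear0).
- by rewrite !(pureTDr, linearD) Et Eu.
by rewrite comul3E tassocV_purer mul2E !tmapE.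
Qed.

(** Both sides are a1 b1 c (x) a2 b2 (x) x, by multiplicativity of delta and
    associativity of m. *)
Lemma bialgebra_dist_mul M :
  distH M \oh mulH (B *t* M)
    = tmap (hid B) (mulH M) \oh distH (B *t* M) \oh tmap (hid B) (distH M).
Proof.
apply: tens_ext3 => a b t; elim/tens_ind: t => [|t u Et Eu|c x].
- by rewrite !(pureT0r, linear0).
- by rewrite !(pureTDr, linearD) Et Eu.
rewrite [LHS]hcompE tens_mulE tens_distE comul_mulE.
rewrite (hcompE (tmap (hid B) (mulH M) \oh distH (B *t* M)) (tmap (hid B) (distH M))).
rewrite (hcompE (tmap (hid B) (mulH M)) (distH (B *t* M))).
rewrite (tmapE (hid B) (distH M)) tens_distE.
elim/tens_ind: (delta b) => [|t u Et Eu|b1 b2].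
- by rewrite !(pureT0r, linear0).
- by rewrite !(pureTDr, linearD) Et Eu.
rewrite tmapE tens_distE.
elim/tens_ind: (delta a) => [|t u Et Eu|a1 a2].
- by rewrite !(pureT0l, linear0).
- by rewrite !(pureTDl, linearD) Et Eu.
rewrite mul2E !tmapE tens_mulE.
by rewrite -[mulr_by c _]/(m (_ ** _)) mul_assocE.
Qed.

Lemma bialgebra_bimonad : is_bimonad_mc D.
Proof.
split; first exact: bialgebra_unit_counit.
  move=> M; split.
  - exact: bialgebra_dist_unit.
  - exact: bialgebra_dist_counit.
  - exact: bialgebra_dist_comul.
  - exact: bialgebra_dist_mul.
move=> M; apply: tens_ext3 => b c x; rewrite [RHS]tens_mul_comulE.
by rewrite [LHS]hcompE tens_mulE tens_comulE comul_mulE.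
Qed.
End FromBialgebra.

Lemma tens_antipodeE M (S : forall M : lmodType R, Hom (B *t* M) (B *t* M))
    (S0 : Hom B B) (b : B) (x : M) :
  (forall N (c : B) (y : N), S N (c ** y) = S0 c ** y) ->
  (mulH M \oh S (B *t* M) \oh comulH M) (b ** x)
    = (m \oh tmap S0 (hid B) \oh delta) b ** x /\
  (mulH M \oh tmap (hid B) (S M) \oh comulH M) (b ** x)
    = (m \oh tmap (hid B) S0 \oh delta) b ** x.
Proof.
move=> SE.
have El : (mulH M (S (B *t* M) (comulH M (b ** x))))
    = (m \oh tmap S0 (hid B) \oh delta) b ** x.
  rewrite tens_comulE ![in RHS]hcompE; elim/tens_ind: (delta b) => [|t u Et Eu|b1 b2].
  - by rewrite !(pureT0l, linear0).
  - by rewrite !(pureTDl, linearD) Et Eu.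
  by rewrite !tmapE SE tens_mulE.
have Er : (mulH M (tmap (hid B) (S M) (comulH M (b ** x))))
    = (m \oh tmap (hid B) S0 \oh delta) b ** x.
  rewrite tens_comulE ![in RHS]hcompE; elim/tens_ind: (delta b) => [|t u Et Eu|b1 b2].
  - by rewrite !(pureT0l, linear0).
  - by rewrite !(pureTDl, linearD) Et Eu.
  by rewrite !tmapE SE tens_mulE.
by split.
Qed.

Lemma tens_unit_counitE M (b : B) (x : M) :
  (unitH M \oh counitH M) (b ** x) = (e \oh eps) b ** x.
Proof.
rewrite [LHS]hcompE tens_counitE tens_unitE pureTZr -pureTZl hcompE.
by rewrite (regM_homE e (eps b)).
Qed.

(** Naturality along the map R -> M sending 1 to x determines S on b (x) x from
    its component at R. *)
Lemma tens_nattransE (S : H ~~> H) : exists S0 : Hom B B,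
  forall M (b : B) (x : M), S M (b ** x) = S0 b ** x.
Proof.
exists (trunit B \oh S (regM R) \oh trunitV B) => M b x.
pose f : Hom (regM R) M := tlunit M \oh purer (regM R) x.
have fE (a : regM R) : f a = (a : R) *: x by rewrite /f hcompE tlunitE.
have -> : b ** x = fmap H f (b ** (1 : regM R)) by rewrite tmapE fE scale1r.
rewrite -[LHS]/((S M \oh fmap H f) _) naturality !hcompE.
rewrite -[trunitV B b]/(b ** (1 : regM R)).
elim/tens_ind: (S _ _) => [|t u Et Eu|c a].
- by rewrite !(pureT0l, linear0).
- by rewrite !(pureTDl, linearD) Et Eu.
by rewrite tmapE trunitE fE pureTZl pureTZr.
Qed.

Fact tens_nattrans_nat (S0 : Hom B B) M N (f : Hom M N) :
  tmap S0 (hid N) \oh tmap (hid B) f = tmap (hid B) f \oh tmap S0 (hid M).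
Proof. exact: tmap_exch. Qed.
Definition tens_nattrans (S0 : Hom B B) : H ~~> H :=
  @Nattrans R H H (fun M => tmap S0 (hid M)) (tens_nattrans_nat S0).

Lemma tens_antipode : has_antipode D <-> exists S, is_antipode A C S.
Proof.
split=> [[S hS] | [S0 [hl hr]]].
  have [S0 SE] := tens_nattransE S; exists S0.
  have E M (b : B) (x : M) :
      (m \oh tmap S0 (hid B) \oh delta) b ** x = (e \oh eps) b ** x /\
      (m \oh tmap (hid B) S0 \oh delta) b ** x = (e \oh eps) b ** x.
    have [<- <-] := tens_antipodeE b x SE; rewrite -tens_unit_counitE.
    by have [El Er] := hS M; split; apply: hom_app.
  split; apply: hom_ext => b; apply: pureT1_inj.
    exact: (E (regM R) b 1).1.
  exact: (E (regM R) b 1).2.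
exists (tens_nattrans S0) => M.
have SE N (c : B) (y : N) : tens_nattrans S0 N (c ** y) = S0 c ** y.
  exact: tmapE.
split; apply: tens_ext => b x; rewrite [RHS]tens_unit_counitE.
  by have [El _] := tens_antipodeE b x SE; rewrite [LHS]El hl.
by have [_ Er] := tens_antipodeE b x SE; rewrite [LHS]Er hr.
Qed.
End TensMonad.

(** * Mates under an adjunction *)

Section MateCalculus.
Variable R : comPzRingType.
Implicit Types (F G H T : endofunctor R) (M N : lmodType R).

Definition is_natural F F' (t : forall M, Hom (F M) (F' M)) : Prop :=
  forall M N (f : Hom M N), t N \oh fmap F f = fmap F' f \oh t M.

(** For adjunctions F -| G and F' -| G' with counits u and u', this says that s is
    the mate of t.  It only speaks of objects, maps and components, so that it is
    unaffected by the bracketing of composite functors, whereas H (HH) and (HH) H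
    are different as terms of type endofunctor. *)
Definition mate_rel F G F' G' (u : forall M, Hom (F (G M)) M)
    (u' : forall M, Hom (F' (G' M)) M)
    (t : forall M, Hom (F M) (F' M)) (s : forall M, Hom (G' M) (G M)) : Prop :=
  is_natural t /\ forall M, u M \oh fmap F (s M) = u' M \oh t (G' M).

Lemma mate_rel_mate F G F' G' (a : adjunction F G) (a' : adjunction F' G')
    (t : F ~~> F') :
  mate_rel (adj_counit a) (adj_counit a') t (mate a a' t).
Proof.
split=> [M N f | M]; first exact: naturality.
rewrite /= /mate_comp !fmap_comp -!hcompA.
rewrite hcompA adj_counit_nat -hcompA (hcompA (adj_counit a _)) adj_counit_nat.
by rewrite -!hcompA adj_triangleF hcomph1.
Qed.

(** Taking mates reverses composition. *)
Lemma mate_rel_comp F G F' G' F'' G'' (u : forall M, Hom (F (G M)) M)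
    (u' : forall M, Hom (F' (G' M)) M) (u'' : forall M, Hom (F'' (G'' M)) M)
    t s t' s' :
  mate_rel u u' t s -> mate_rel u' u'' t' s' ->
  mate_rel u u'' (fun M => t' M \oh t M) (fun M => s M \oh s' M).
Proof.
move=> [nt ts] [nt' ts']; split=> [M N f | M].
  by rewrite -hcompA nt !hcompA nt'.
by rewrite fmap_comp hcompA ts -hcompA nt hcompA ts' -hcompA.
Qed.

Lemma mate_rel_comp3 F0 G0 F1 G1 F2 G2 F3 G3
    (u0 : forall M, Hom (F0 (G0 M)) M) (u1 : forall M, Hom (F1 (G1 M)) M)
    (u2 : forall M, Hom (F2 (G2 M)) M) (u3 : forall M, Hom (F3 (G3 M)) M)
    t1 s1 t2 s2 t3 s3 :
  mate_rel u0 u1 t1 s1 -> mate_rel u1 u2 t2 s2 -> mate_rel u2 u3 t3 s3 ->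
  mate_rel u0 u3 (fun M => t3 M \oh t2 M \oh t1 M)
    (fun M => s1 M \oh s2 M \oh s3 M).
Proof.
move=> r1 r2 r3; have [n E] := mate_rel_comp r1 (mate_rel_comp r2 r3).
by split=> [M N f | M]; [apply: n | rewrite -(hcompA (s1 M)) E].
Qed.

(** Whiskering by H on the left becomes whiskering by T on the right; the
    counits w and w' of the composite adjunctions enter through their formulas,
    because composites bracketed differently have equal but not convertible
    counits. *)
Lemma mate_rel_left F G F' G' H T (a : adjunction H T)
    (u : forall M, Hom (F (G M)) M) (u' : forall M, Hom (F' (G' M)) M)
    (w : forall M, Hom ((H \of F) ((G \of T) M)) M)
    (w' : forall M, Hom ((H \of F') ((G' \of T) M)) M) t s :
  (forall M, w M = adj_counit a M \oh fmap H (u (T M))) ->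
  (forall M, w' M = adj_counit a M \oh fmap H (u' (T M))) ->
  mate_rel u u' t s ->
  @mate_rel (H \of F) (G \of T) (H \of F') (G' \of T) w w'
    (fun M => fmap H (t M)) (fun M => s (T M)).
Proof.
move=> wE w'E [nt ts]; split=> [M N f | M] /=; first by rewrite -!fmap_comp nt.
by rewrite wE w'E -!hcompA -!fmap_comp ts.
Qed.

Lemma mate_rel_right F G F' G' H T (a : adjunction H T)
    (u : forall M, Hom (F (G M)) M) (u' : forall M, Hom (F' (G' M)) M)
    (w : forall M, Hom ((F \of H) ((T \of G) M)) M)
    (w' : forall M, Hom ((F' \of H) ((T \of G') M)) M) t s :
  (forall M, w M = u M \oh fmap F (adj_counit a (G M))) ->
  (forall M, w' M = u' M \oh fmap F' (adj_counit a (G' M))) ->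
  mate_rel u u' t s ->
  @mate_rel (F \of H) (T \of G) (F' \of H) (T \of G') w w'
    (fun M => t (H M)) (fun M => fmap T (s M)).
Proof.
move=> wE w'E [nt ts]; split=> [M N f | M]; first exact: nt.
rewrite wE w'E -[LHS]hcompA -[RHS]hcompA.
have -> : fmap F (adj_counit a (G M)) \oh fmap (F \of H) (fmap T (s M))
    = fmap F (s M) \oh fmap F (adj_counit a (G' M)).
  by rewrite -fmap_comp -adj_counit_nat fmap_comp.
by rewrite [LHS]hcompA (ts M) -[LHS]hcompA; congr (_ \oh _); apply: nt.
Qed.

(** Taking mates is a bijection: s is recovered from t through the unit of
    F -| G, and t from s through the unit of F' -| G' and naturality of t. *)
Lemma mate_rel_eq F G F' G' (a : adjunction F G) (a' : adjunction F' G')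
    t1 s1 t2 s2 :
  mate_rel (adj_counit a) (adj_counit a') t1 s1 ->
  mate_rel (adj_counit a) (adj_counit a') t2 s2 ->
  (forall M, t1 M = t2 M) <-> (forall M, s1 M = s2 M).
Proof.
move=> [nt1 ts1] [nt2 ts2]; split=> E M.
  suff K s : s = fmap G (adj_counit a M \oh fmap F s) \oh adj_unit a (G' M).
    by rewrite (K (s1 M)) (K (s2 M)) ts1 ts2 E.
  by rewrite fmap_comp -hcompA -adj_unit_nat hcompA adj_triangleG hcomp1h.
suff K (t : forall M, Hom (F M) (F' M)) s (nt : is_natural t)
    (ts : forall M, adj_counit a M \oh fmap F (s M) = adj_counit a' M \oh t (G' M)) :
    t M = adj_counit a (F' M) \oh fmap F (s (F' M) \oh adj_unit a' M).
  by rewrite (K t1 s1) // (K t2 s2) // E.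
by rewrite fmap_comp hcompA ts -hcompA nt hcompA adj_triangleF hcomp1h.
Qed.

(** The passage from s back to t, by which an antipode of T gives one of H. *)
Section InverseMate.
Variables (F G : endofunctor R) (a : adjunction F G) (s : G ~~> G).

Definition comate_comp M : Hom (F M) (F M) :=
  adj_counit a (F M) \oh fmap F (s (F M) \oh adj_unit a M).

Fact comate_nat : is_natural comate_comp.
Proof.
move=> M N f; rewrite /comate_comp -hcompA -fmap_comp -hcompA adj_unit_nat hcompA.
by rewrite naturality -hcompA fmap_comp hcompA adj_counit_nat hcompA.
Qed.

Definition comate : F ~~> F := Nattrans comate_nat.

Lemma mate_rel_comate : mate_rel (adj_counit a) (adj_counit a) comate s.
Proof.
split=> [|M]; first exact: comate_nat.
rewrite /= /comate_comp hcompA -adj_counit_nat -hcompA -fmap_comp hcompA.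
by rewrite -(naturality s) -hcompA adj_triangleG hcomph1.
Qed.
End InverseMate.
End MateCalculus.

(** The lemmas on whiskered structure maps below carry the prefix l for H t and r
    for t H. *)
Section MateData.
Variables (R : comPzRingType) (H T : endofunctor R) (a : adjunction H T).
Variable D : bimonad_data H.
Let adj0 := adj_id R.
Let adj2 := adj_comp a a.
Let adj3 := adj_comp a adj2.

Definition mate_data : bimonad_data T := @BimonadData R T
  (mate a adj2 (bcomul D)) (mate a adj0 (bcounit D))
  (mate adj2 a (bmul D)) (mate adj0 a (bunit D)) (mate adj2 adj2 (bdist D)).

Local Notation D' := mate_data.

Let u0 : forall M : lmodType R, Hom M M := adj_counit adj0.
Let u1 := adj_counit a.
Let u2 := adj_counit adj2.
Let u3 := adj_counit adj3.
Let w1 M : u1 M = u0 M \oh adj_counit a M.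
Proof. by rewrite hcomp1h. Qed.
Let w2 M : u2 M = u1 M \oh fmap H (u1 (T M)). Proof. by []. Qed.
(* The counit at depth three, associated the other way. *)
Let w3 M : u3 M = u2 M \oh fmap H (fmap H (u1 (T (T M)))).
Proof.
by rewrite /u3 /= /adj_comp_counit /= /adj_comp_counit fmap_comp !hcompA.
Qed.

Local Notation H2 := (H \of H).
Local Notation T2 := (T \of T).
Local Notation H3 := (H \of H2).
Local Notation T3 := (T2 \of T).

Let mu : @mate_rel R H2 T2 H T u2 u1 (bmul D) (bcomul D').
Proof. exact: mate_rel_mate. Qed.
Let eta : @mate_rel R (fid R) (fid R) H T u0 u1 (bunit D) (bcounit D').
Proof. exact: mate_rel_mate. Qed.
Let delta : @mate_rel R H T H2 T2 u1 u2 (bcomul D) (bmul D').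
Proof. exact: mate_rel_mate. Qed.
Let eps : @mate_rel R H T (fid R) (fid R) u1 u0 (bcounit D) (bunit D').
Proof. exact: mate_rel_mate. Qed.
Let lam : @mate_rel R H2 T2 H2 T2 u2 u2 (bdist D) (bdist D').
Proof. exact: mate_rel_mate. Qed.

Let one : @mate_rel R (fid R) (fid R) (fid R) (fid R) u0 u0
  (fun M => hid M) (fun M => hid M).
Proof. by split=> [M N f | M]; rewrite [LHS]hcomp1h [RHS]hcomph1. Qed.

Let wl M : u1 M = adj_counit a M \oh fmap H (u0 (T M)).
Proof. by rewrite fmap_id hcomph1. Qed.

Let w3l M : u3 M = u1 M \oh fmap H (u2 (T M)).
Proof. by []. Qed.

Let l_eta : @mate_rel R H T H2 T2 u1 u2
  (fun M => fmap H (bunit D M)) (fun M => bcounit D' (T M)).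
Proof. exact: (@mate_rel_left R (fid R) (fid R) H T H T a _ _ _ _ _ _ wl w2 eta). Qed.
Let r_eta : @mate_rel R H T H2 T2 u1 u2
  (fun M => bunit D (H M)) (fun M => fmap T (bcounit D' M)).
Proof. exact: (@mate_rel_right R (fid R) (fid R) H T H T a _ _ _ _ _ _ w1 w2 eta). Qed.
Let l_eps : @mate_rel R H2 T2 H T u2 u1
  (fun M => fmap H (bcounit D M)) (fun M => bunit D' (T M)).
Proof. exact: (@mate_rel_left R H T (fid R) (fid R) H T a _ _ _ _ _ _ w2 wl eps). Qed.
Let r_eps : @mate_rel R H2 T2 H T u2 u1
  (fun M => bcounit D (H M)) (fun M => fmap T (bunit D' M)).
Proof. exact: (@mate_rel_right R H T (fid R) (fid R) H T a _ _ _ _ _ _ w2 w1 eps). Qed.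
Let l_mu : @mate_rel R H3 T3 H2 T2 u3 u2
  (fun M => fmap H (bmul D M)) (fun M => bcomul D' (T M)).
Proof. exact: (@mate_rel_left R H2 T2 H T H T a _ _ _ _ _ _ w3l w2 mu). Qed.
Let r_mu : @mate_rel R H3 T3 H2 T2 u3 u2
  (fun M => bmul D (H M)) (fun M => fmap T (bcomul D' M)).
Proof. exact: (@mate_rel_right R H2 T2 H T H T a _ _ _ _ _ _ w3 w2 mu). Qed.
Let l_delta : @mate_rel R H2 T2 H3 T3 u2 u3
  (fun M => fmap H (bcomul D M)) (fun M => bmul D' (T M)).
Proof. exact: (@mate_rel_left R H T H2 T2 H T a _ _ _ _ _ _ w2 w3l delta). Qed.
Let r_delta : @mate_rel R H2 T2 H3 T3 u2 u3
  (fun M => bcomul D (H M)) (fun M => fmap T (bmul D' M)).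
Proof. exact: (@mate_rel_right R H T H2 T2 H T a _ _ _ _ _ _ w2 w3 delta). Qed.
Let l_lam : @mate_rel R H3 T3 H3 T3 u3 u3
  (fun M => fmap H (bdist D M)) (fun M => bdist D' (T M)).
Proof. exact: (@mate_rel_left R H2 T2 H2 T2 H T a _ _ _ _ _ _ w3l w3l lam). Qed.
Let r_lam : @mate_rel R H3 T3 H3 T3 u3 u3
  (fun M => bdist D (H M)) (fun M => fmap T (bdist D' M)).
Proof. exact: (@mate_rel_right R H2 T2 H2 T2 H T a _ _ _ _ _ _ w3 w3 lam). Qed.

(** The second and third equations are exchanged by duality; the first is
    self-dual. *)
Lemma unit_counit_compat_mate :
  unit_counit_compat D <-> unit_counit_compat D'.
Proof.
have [E1 E1'] := mate_rel_eq (a := adj0) (a' := adj0) (mate_rel_comp eta eps) one.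
have [E2 E2'] := mate_rel_eq (a := adj2) (a' := adj0) (mate_rel_comp mu eps)
  (mate_rel_comp l_eps eps).
have [E3 E3'] := mate_rel_eq (a := adj0) (a' := adj2) (mate_rel_comp eta delta)
  (mate_rel_comp eta r_eta).
split=> h M; split.
- exact: (E1 (fun N => let: And3 e _ _ := h N in e)).
- exact: (E3 (fun N => let: And3 _ _ e := h N in e)).
- exact: (E2 (fun N => let: And3 _ e _ := h N in e)).
- exact: (E1' (fun N => let: And3 e _ _ := h N in e)).
- exact: (E2' (fun N => let: And3 _ _ e := h N in e)).
- exact: (E3' (fun N => let: And3 _ e _ := h N in e)).
Qed.

(** The equations for the unit and the counit are exchanged, and so are those
    for the multiplication and the comultiplication. *)
Lemma entwining_mate : entwining_mc D <-> entwining_cm D'.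
Proof.
have [E1 E1'] := mate_rel_eq (a := a) (a' := adj2) (mate_rel_comp r_eta lam) l_eta.
have [E2 E2'] := mate_rel_eq (a := adj2) (a' := a) (mate_rel_comp lam r_eps) l_eps.
have [E3 E3'] := mate_rel_eq (a := adj2) (a' := adj3)
  (mate_rel_comp lam r_delta) (mate_rel_comp3 l_delta r_lam l_lam).
have [E4 E4'] := mate_rel_eq (a := adj3) (a' := adj2)
  (mate_rel_comp r_mu lam) (mate_rel_comp3 l_lam r_lam l_mu).
split=> h M; split.
- exact: (E2 (fun N => let: And4 _ e _ _ := h N in e)).
- exact: (E1 (fun N => let: And4 e _ _ _ := h N in e)).
- exact: (E4 (fun N => let: And4 _ _ _ e := h N in e)).
- exact: (E3 (fun N => let: And4 _ _ e _ := h N in e)).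
- exact: (E1' (fun N => let: And4 _ e _ _ := h N in e)).
- exact: (E2' (fun N => let: And4 e _ _ _ := h N in e)).
- exact: (E3' (fun N => let: And4 _ _ _ e := h N in e)).
- exact: (E4' (fun N => let: And4 _ _ e _ := h N in e)).
Qed.

Lemma is_bimonad_mate : is_bimonad_mc D <-> is_bimonad_cm D'.
Proof.
have [E E'] := mate_rel_eq (a := adj2) (a' := adj2)
  (mate_rel_comp mu delta) (mate_rel_comp3 l_delta r_lam l_mu).
split=> -[h1 h2 h3]; split.
- exact/unit_counit_compat_mate.
- exact/entwining_mate.
- exact: (E h3).
- exact/unit_counit_compat_mate.
- exact/entwining_mate.
- exact: (E' h3).
Qed.

Let antipode_mate (S : H ~~> H) (S' : T ~~> T) :
  @mate_rel R H T H T u1 u1 S S' ->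
  (forall M : lmodType R,
     bmul D M \oh S (H M) \oh bcomul D M = bunit D M \oh bcounit D M /\
     bmul D M \oh fmap H (S M) \oh bcomul D M = bunit D M \oh bcounit D M) <->
  (forall M : lmodType R,
     bmul D' M \oh S' (T M) \oh bcomul D' M = bunit D' M \oh bcounit D' M /\
     bmul D' M \oh fmap T (S' M) \oh bcomul D' M = bunit D' M \oh bcounit D' M).
Proof.
move=> SS'.
have rS := @mate_rel_right R H T H T H T a _ _ _ _ _ _ w2 w2 SS'.
have lS := @mate_rel_left R H T H T H T a _ _ _ _ _ _ w2 w2 SS'.
have [E1 E1'] := mate_rel_eq (a := a) (a' := a)
  (mate_rel_comp3 delta rS mu) (mate_rel_comp eps eta).
have [E2 E2'] := mate_rel_eq (a := a) (a' := a)
  (mate_rel_comp3 delta lS mu) (mate_rel_comp eps eta).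
split=> h M; split.
- exact: (E2 (fun N => proj2 (h N))).
- exact: (E1 (fun N => proj1 (h N))).
- exact: (E1' (fun N => proj2 (h N))).
- exact: (E2' (fun N => proj1 (h N))).
Qed.

Lemma has_antipode_mate : has_antipode D <-> has_antipode D'.
Proof.
split=> -[S hS].
  exists (mate a a S); apply/(antipode_mate (S := S)) => //.
  exact: mate_rel_mate.
by exists (comate a S); apply/(antipode_mate (mate_rel_comate a S)).
Qed.
End MateData.

(** * The dual of a finitely generated projective module *)

Lemma evd0 (R : comPzRingType) (M : lmodType R) (f : dual M) : evd 0 f = 0.
Proof. exact: linear0 (f : Hom M (regM R)). Qed.

Lemma evdD (R : comPzRingType) (M : lmodType R) (x y : M) (f : dual M) :
  evd (x + y) f = evd x f + evd y f.
Proof. exact: linearD (f : Hom M (regM R)) x y. Qed.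

Section DualHopf.
Variables (R : comPzRingType) (B : lmodType R).
Variables (A : algebra B) (C : coalgebra B) (hB : fg_projective B).
Local Notation m := (amul A).
Local Notation e := (aunit A).
Local Notation delta := (ccomul C).
Local Notation eps := (ccounit C).
Local Notation A' := (dual_algebra C).
Local Notation C' := (dual_coalgebra A hB).
Local Notation dB := (dual B).
Local Notation kBB := (kappa B B).

Lemma dual_separates (x y : B) :
  (forall f : dB, evd x f = evd y f) -> x = y.
Proof.
have [n [b [nu bnu]]] := dual_basis hB.
by move=> xy; rewrite (bnu x) (bnu y); apply: eq_bigr => i _; rewrite xy.
Qed.

(** For a dual basis (b, nu) of B, a tensor expands in the b i (x) b j with the
    values of nu i (x) nu j as coefficients. *)
Lemma dual_tens_separates (s t : B *t* B) :
  (forall f g : dB, evd s (kBB (f ** g)) = evd t (kBB (f ** g))) -> s = t.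
Proof.
have [n [b [nu bnu]]] := dual_basis hB.
suff K u : u = \sum_i \sum_j (evd u (kBB (nu i ** nu j)) : R) *: (b i ** b j).
  move=> st; rewrite (K s) (K t).
  by apply: eq_bigr => i _; apply: eq_bigr => j _; rewrite st.
elim/tens_ind: u => [|u v Eu Ev|x y].
- rewrite big1 // => i _; rewrite big1 // => j _.
  by rewrite evd0 scale0r.
- rewrite {1}Eu {1}Ev -big_split; apply: eq_bigr => i _.
  by rewrite -big_split; apply: eq_bigr => j _; rewrite evdD scalerDl.
rewrite {1}(bnu x) -[LHS]/(purer B y (\sum_i _)) linear_sum.
apply: eq_bigr => i _; rewrite linearZ_LR -[purer B y _]/(b i ** y).
rewrite {1}(bnu y) -[_ ** _]/(purel B (b i) (\sum_j _)) linear_sum scaler_sumr.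
by apply: eq_bigr => j _; rewrite linearZ_LR scalerA kappaE.
Qed.

Lemma dual_map_inj M (f g : Hom M B) : dual_map f = dual_map g -> f = g.
Proof.
move=> fg; apply: hom_ext => x; apply: dual_separates => h.
by rewrite -!evd_map fg.
Qed.

Lemma dual_map_inj2 M (f g : Hom M (B *t* B)) :
  dual_map f \oh kBB = dual_map g \oh kBB -> f = g.
Proof.
move=> fg; apply: hom_ext => x; apply: dual_tens_separates => h k.
rewrite -!evd_map -[dual_map f _]/((dual_map f \oh kBB) (h ** k)) fg.
by rewrite hcompE.
Qed.

Lemma kappa_dual_comul : kBB \oh ccomul C' = dual_map m.
Proof. by rewrite /= /dual_comul hcompA kappa_invK hcomp1h. Qed.

Lemma dual_mulE : amul A' = dual_map delta \oh kBB. Proof. by []. Qed.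

(* (dB (x) dB) (x) (dB (x) dB) -> dual ((B (x) B) (x) (B (x) B)) *)
Let k4 := kappa (B *t* B) (B *t* B) \oh tmap kBB kBB.

Let k4E (f g h k : dB) (x y z w : B) :
  evd (x ** y ** (z ** w)) (k4 (f ** g ** (h ** k)))
    = (evd x f : R) * evd y g * ((evd z h : R) * evd w k).
Proof. by rewrite /k4 hcompE tmapE !kappaE. Qed.

Lemma kappa_middle_twist :
  k4 \oh middle_twist dB = dual_map (middle_twist B) \oh k4.
Proof.
apply: tens_ext3V => f g t; elim/tens_ind: t => [|t u Et Eu|h k].
- by rewrite !(pureT0r, linear0).
- by rewrite !(pureTDr, linearD) Et Eu.
apply: dual_tens_ext3V => x y t; elim/tens_ind: t => [|t u Et Eu|z w].
- by rewrite pureT0r !evd0.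
- by rewrite pureTDr !evdD Et Eu.
rewrite (hcompE k4) (hcompE (dual_map _)) evd_map !middle_twistE !k4E.
exact: mulrACA.
Qed.

(** Self-dual: transposing delta . m exchanges delta with m, and the middle twist
    is its own transpose. *)
Lemma dual_comul_mul :
  delta \oh m = tmap m m \oh middle_twist B \oh tmap delta delta <->
  ccomul C' \oh amul A'
    = tmap (amul A') (amul A') \oh middle_twist dB \oh tmap (ccomul C') (ccomul C').
Proof.
have El : kBB \oh (ccomul C' \oh amul A') = dual_map (delta \oh m) \oh kBB.
  by rewrite hcompA kappa_dual_comul dual_mulE hcompA -dual_map_comp.
have Er : kBB \oh (tmap (amul A') (amul A') \oh middle_twist dB
    \oh tmap (ccomul C') (ccomul C'))
  = dual_map (tmap m m \oh middle_twist B \oh tmap delta delta) \oh kBB.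
  have Em : kBB \oh tmap (amul A') (amul A') = dual_map (tmap delta delta) \oh k4.
    by rewrite dual_mulE tmap_comp hcompA kappa_nat -hcompA.
  have Ed : k4 \oh tmap (ccomul C') (ccomul C') = dual_map (tmap m m) \oh kBB.
    by rewrite /k4 -hcompA -tmap_comp kappa_dual_comul kappa_nat.
  have Et := kappa_middle_twist.
  (* Each twist is itself a composite, which reassociation would take apart. *)
  move: (middle_twist dB) (middle_twist B) Et => t t' Et; clearbody k4.
  by rewrite !hcompA Em -(hcompA _ k4) Et -!hcompA Ed !hcompA -!dual_map_comp !hcompA.
split=> E.
  by apply: hom_ext => t; apply: (kappa_inj hB); rewrite -!hcompE El Er E.
by apply: dual_map_inj2; rewrite -El -Er E.
Qed.

Lemma dual_unitE (a : regM R) (x : B) :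
  evd x (aunit A' a) = (a : R) * eps x.
Proof. by []. Qed.

Lemma dual_counitE (f : dB) : ccounit C' f = evd (e (1 : R)) f.
Proof. by []. Qed.

Lemma dual_comul_unit :
  eps \oh m = tlunit (regM R) \oh tmap eps eps <->
  ccomul C' \oh aunit A' = tmap (aunit A') (aunit A') \oh tlunitV (regM R).
Proof.
have El x y : evd (x ** y) (kBB ((ccomul C' \oh aunit A') (1 : R)))
    = (eps \oh m) (x ** y).
  rewrite hcompE -(hcompE kBB) kappa_dual_comul evd_map dual_unitE mul1r.
  by rewrite hcompE.
have Er x y :
    evd (x ** y) (kBB ((tmap (aunit A') (aunit A') \oh tlunitV (regM R)) (1 : R)))
    = (tlunit (regM R) \oh tmap eps eps) (x ** y).
  rewrite (hcompE (tmap _ _)) (tmapE (aunit A')) kappaE !dual_unitE !mul1r.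
  by rewrite (hcompE (tlunit _)) tmapE tlunitE.
split=> E.
  apply: regM_ext; apply: (kappa_inj hB); apply: dual_tens_ext => x y.
  by rewrite El Er E.
by apply: tens_ext => x y; rewrite -El -Er E.
Qed.

Lemma dual_counit_mul :
  delta \oh e = tmap e e \oh tlunitV (regM R) <->
  ccounit C' \oh amul A' = tlunit (regM R) \oh tmap (ccounit C') (ccounit C').
Proof.
have El f g : (ccounit C' \oh amul A') (f ** g)
    = evd ((delta \oh e) (1 : R)) (kBB (f ** g)).
  by rewrite hcompE dual_counitE dual_mulE (hcompE (dual_map _)) evd_map.
have Er f g : (tlunit (regM R) \oh tmap (ccounit C') (ccounit C')) (f ** g)
    = evd ((tmap e e \oh tlunitV (regM R)) (1 : R)) (kBB (f ** g)).
  rewrite (hcompE (tlunit _)) tmapE tlunitE !dual_counitE (hcompE (tmap _ _)).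
  by rewrite (tmapE e) kappaE.
split=> E; first by apply: tens_ext => f g; rewrite El Er E.
by apply: regM_ext; apply: dual_tens_separates => f g; rewrite -El -Er E.
Qed.

Lemma dual_counit_unit : eps \oh e = hid _ <-> ccounit C' \oh aunit A' = hid _.
Proof.
suff E : (ccounit C' \oh aunit A') (1 : R) = (eps \oh e) (1 : R).
  by split=> K; apply: regM_ext; rewrite -?K ?E // -K.
by rewrite hcompE dual_counitE dual_unitE mul1r.
Qed.

Lemma dual_bialgebra : is_bialgebra A C <-> is_bialgebra A' C'.
Proof.
split=> -[h1 h2 h3 h4]; split.
- exact/dual_comul_mul.
- exact/dual_comul_unit.
- exact/dual_counit_mul.
- exact/dual_counit_unit.
- exact/dual_comul_mul.
- exact/dual_counit_mul.
- exact/dual_comul_unit.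
- exact/dual_counit_unit.
Qed.

(** With a dual basis (b, nu), the preimage of S' is
    x |-> sum_i S'(nu i)(x) b i, since any form f is sum_i f(b i) nu i. *)
Lemma dual_map_surj (S' : Hom dB dB) : exists S : Hom B B, dual_map S = S'.
Proof.
have [n [b [nu bnu]]] := dual_basis hB.
have Slin : linear ((fun x => \sum_i (evd x (S' (nu i)) : R) *: b i) : B -> B).
  move=> a x y; rewrite scaler_sumr -big_split; apply: eq_bigr => i _.
  by rewrite evdP scalerDl -scalerA.
exists (mkHom Slin); apply: hom_ext => f.
have {2}-> : f = \sum_i (evd (b i) f : R) *: nu i.
  apply: dual_ext => y; rewrite linear_sum {1}(bnu y).
  rewrite -[LHS]/((f : Hom _ _) (\sum_i _)) linear_sum; apply: eq_bigr => i _.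
  by rewrite [LHS]linearZ_LR [RHS]linearZ_LR; apply: (mulrC (_ : R)).
apply: dual_ext => x; rewrite evd_map !linear_sum.
rewrite -[LHS]/((f : Hom _ _) (\sum_i _)) linear_sum; apply: eq_bigr => i _.
by rewrite [LHS]linearZ_LR !linearZ_LR; apply: (mulrC (_ : R)).
Qed.

Lemma dual_antipode (S : Hom B B) :
  is_antipode A C S <-> is_antipode A' C' (dual_map S).
Proof.
have El : amul A' \oh tmap (dual_map S) (hid dB) \oh ccomul C'
    = dual_map (m \oh tmap S (hid B) \oh delta).
  rewrite dual_mulE -(dual_map_id B) -(hcompA (dual_map delta)) kappa_nat -!hcompA.
  by rewrite kappa_dual_comul !dual_map_comp hcompA.
have Er : amul A' \oh tmap (hid dB) (dual_map S) \oh ccomul C'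
    = dual_map (m \oh tmap (hid B) S \oh delta).
  rewrite dual_mulE -(dual_map_id B) -(hcompA (dual_map delta)) kappa_nat -!hcompA.
  by rewrite kappa_dual_comul !dual_map_comp hcompA.
have Eu : aunit A' \oh ccounit C' = dual_map (e \oh eps).
  apply: hom_ext => f; apply: dual_ext => x.
  rewrite hcompE dual_unitE dual_counitE evd_map (hcompE e) (regM_homE e (eps x)).
  by rewrite -[RHS]/((f : Hom B _) _) linearZ_LR; apply: (mulrC (_ : R)).
rewrite /is_antipode El Er Eu.
by split=> -[h1 h2]; split; first [exact: dual_map_inj | congr dual_map].
Qed.

Lemma dual_hopf : is_hopf_algebra A C <-> is_hopf_algebra A' C'.
Proof.
split=> -[/dual_bialgebra hb [S hS]]; split=> //.
  by exists (dual_map S); apply/dual_antipode.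
have [S0 S0E] := dual_map_surj S.
by exists S0; apply/dual_antipode; rewrite S0E.
Qed.
End DualHopf.

Theorem mainTheorem4 (R : comPzRingType) (B : lmodType R)
    (A : algebra B) (C : coalgebra B) :
  (* (1) *)
  (is_hopf_algebra A C <->
     is_bimonad_mc (tens_data A C) /\ has_antipode (tens_data A C)) /\
  (* (2) *)
  ((is_bimonad_mc (tens_data A C) <-> is_bimonad_cm (hom_data A C)) /\
   (is_bimonad_mc (tens_data A C) /\ has_antipode (tens_data A C) <->
      is_bimonad_cm (hom_data A C) /\ has_antipode (hom_data A C))) /\
  (* (3) *)
  (forall hB : fg_projective B,
     is_hopf_algebra A C <->
       is_hopf_algebra (dual_algebra C) (dual_coalgebra A hB)).
Proof.
have bimonad_mate := is_bimonad_mate (tens_hom_adj B) (tens_data A C).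
have antipode_mate := has_antipode_mate (tens_hom_adj B) (tens_data A C).
split; [|split; [split|]].
- split=> -[hb hS]; split.
  + exact: bialgebra_bimonad.
  + exact/tens_antipode.
  + exact: bimonad_bialgebra.
  + exact/tens_antipode.
- exact: bimonad_mate.
- split=> -[/bimonad_mate hb /antipode_mate hS].
    by split; [exact: hb | exact: hS].
  by split; [exact: hb | exact: hS].
- exact: dual_hopf.
Qed.
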